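(* Let $d\ge 2$, let $(\mathcal T,o)$ be a unimodular random rooted tree of degree at most $d$ whose growth $\mathrm{gr}(\mathcal T)=\lim_{n\to\infty}|B_{\mathcal T}(o,n)|^{1/n}$ exists almost surely, and let $\mathcal E$ be an invariant edge percolation on the $d$-regular tree $\mathcal T_d$ with root $o$ such that the cluster $(\mathcal E(o),o)$ of the root has the law of $(\mathcal T,o)$; realize $\mathcal T$ as $\mathcal E(o)$. Let $\gamma:=\log \mathrm{gr}(\mathcal T)$ and let $$\rho^{\mathcal E}:=\lim_{n\to\infty}\mathbb P[X_{2n}\in\mathcal E(o)]^{1/2n},$$ where $(X_n)$ is the lazy random walk on $\mathcal T_d$ started at $o$, independent of $\mathcal E$, and $\mathbb P$ is the probability over the walk with $\mathcal E$ fixed. Then almost surely $$\rho^{\mathcal E}=\begin{cases}\dfrac{\sqrt{d-1}}{d}\left(\dfrac{e^{\gamma}}{\sqrt{d-1}}+\dfrac{\sqrt{d-1}}{e^{\gamma}}\right) & \text{if }\gamma\ge\frac12\log(d-1),\\[2mm] \dfrac{2\sqrt{d-1}}{d}&\text{otherwise.}\end{cases}$$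
   Context: $B_{\mathcal T}(o,n)$ is the set of vertices at graph distance at most $n$ from $o$. An invariant edge percolation on $\mathcal T_d$ is a random subset $\mathcal E$ of the edges of $\mathcal T_d$ whose law is invariant under the automorphism group of $\mathcal T_d$; $\mathcal E(o)$ is the connected component of $o$ in the graph with edge set $\mathcal E$. By a theorem of Benjamini, Lyons and Schramm every unimodular random rooted tree of degree at most $d$ arises as the cluster of the root of such a percolation. The lazy random walk on $\mathcal T_d$ stays in place with probability $1/2$ and moves to each neighbor with probability $1/(2d)$ at each step. The limit defining $\rho^{\mathcal E}$ exists almost surely. A random rooted graph $(G,o)$ of degrees bounded by $d$ is a random element of the space of isomorphism classes of connected rooted graphs with degrees at most $d$ (with the local topology, given by isomorphism of balls around the root). It is unimodular if it satisfies the Mass Transport Principle: for every measurable non-negative function $F$ on (isomorphism classes of) triples $(G,x,y)$, with $G$ a bounded degree connected graph and $x,y\in V(G)$, one has $\mathbb E(\sum_{x\in V(G)}F(G,o,x))=\mathbb E(\sum_{x\in V(G)}F(G,x,o))$, provided one of the sides is finite. A unimodular random rooted tree is a unimodular random rooted graph that is almost surely a tree.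
   Formalization: The displayed formula is false for the lazy walk (d=17, empty percolation: 8/17 < 1/2 ≤ ρ); it is proved instead for the simple random walk (each neighbor with probability 1/d), and for the lazy walk ρ is shown to be (1 + displayed value)/2. *)

(* Defs.v *)
From HB Require Import structures.
From mathcomp Require Import all_boot all_order all_algebra.
From mathcomp Require Import finmap.
From mathcomp Require Import all_classical all_reals all_analysis.
From mathcomp Require Import measurable_realfun.

Set Implicit Arguments.
Unset Strict Implicit.
Unset Printing Implicit Defensive.

Import Order.TTheory GRing.Theory Num.Theory.
Import numFieldNormedType.Exports.

Local Open Scope classical_set_scope.
Local Open Scope card_scope.
Local Open Scope ring_scope.

Record graph (V : Type) := Graph { gvert : set V ; gedge : rel V }.

Definition simple_graph V (G : graph V) : Prop :=
  [/\ symmetric (gedge G), irreflexive (gedge G) &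
      forall x y, gedge G x y -> gvert G x].

Definition connected_graph V (G : graph V) : Prop :=
  forall x y, gvert G x -> gvert G y ->
    exists p : seq V, path (gedge G) x p /\ last x p = y.

Definition acyclic_graph (V : eqType) (G : graph V) : Prop :=
  forall c : seq V, ucycle (gedge G) c -> (size c < 3)%N.

Definition neighbors V (G : graph V) (x : V) : set V := [set y | gedge G x y].

Definition degree_le V (d : nat) (G : graph V) : Prop :=
  forall x, gvert G x -> neighbors G x #<= `I_d.

Definition regular_tree (V : eqType) (d : nat) (G : graph V) : Prop :=
  [/\ simple_graph G, gvert G = setT, connected_graph G, acyclic_graph G &
      forall x, neighbors G x #= `I_d].

(* Graph distance at most n, i.e. joined by a path with at most n edges. *)
Definition gball V (G : graph V) (x : V) (n : nat) : set V :=
  [set y | exists p : seq V,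
     [/\ path (gedge G) x p, last x p = y & (size p <= n)%N]].

Definition induced V (G : graph V) (A : set V) : graph V :=
  Graph (gvert G `&` A)
        (fun x y => [&& gedge G x y, `[< A x >] & `[< A y >]]).

Definition graph_iso V W (G : graph V) (H : graph W) (f : V -> W) : Prop :=
  set_bij (gvert G) (gvert H) f /\
  forall x y, gvert G x -> gvert G y -> gedge H (f x) (f y) = gedge G x y.

Section growth.
Variable R : realType.

Definition growth_seq (V : choiceType) (G : graph V) (x : V) : nat -> R :=
  fun n => (#|` fset_set (gball G x n)|%:R : R) `^ (n%:R)^-1.

Definition has_growth (V : choiceType) (G : graph V) (x : V) : Prop :=
  cvgn (growth_seq G x).

Definition growth (V : choiceType) (G : graph V) (x : V) : R :=
  limn (growth_seq G x).

End growth.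

(* Connected graphs of degree at most d are countable, so every isomorphism
   class has a representative whose vertices are natural numbers. *)
Record cgraph (d : nat) := CGraph {
  cgraph_val :> graph nat ;
  cgraph_simple : simple_graph cgraph_val ;
  cgraph_connected : connected_graph cgraph_val ;
  cgraph_degree : degree_le d cgraph_val }.

Definition vertex d (G : cgraph d) := set_type (gvert G).

Record rgraph (d : nat) := RGraph {
  rg_graph :> cgraph d ; rg_root : vertex rg_graph }.

Record bigraph (d : nat) := BiGraph {
  bg_graph :> cgraph d ; bg_fst : vertex bg_graph ; bg_snd : vertex bg_graph }.

(* The sigma-algebras are generated by the basic open sets of the local
   topology: the graphs whose ball of radius r around the root is isomorphic to
   a given one.  All measurable sets are unions of isomorphism classes, so
   measures and measurable functions on rgraph, bigraph are those on the spaces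
   of isomorphism classes. *)
Definition rg_iso_balls d (r : nat) (G H : rgraph d) : Prop :=
  exists f : nat -> nat,
    graph_iso (induced G (gball G (val (rg_root G)) r))
              (induced H (gball H (val (rg_root H)) r)) f /\
    f (val (rg_root G)) = val (rg_root H).

Definition bg_iso_balls d (r : nat) (G H : bigraph d) : Prop :=
  exists f : nat -> nat,
    [/\ graph_iso (induced G (gball G (val (bg_fst G)) r))
                  (induced H (gball H (val (bg_fst H)) r)) f,
        f (val (bg_fst G)) = val (bg_fst H) &
        f (val (bg_snd G)) = val (bg_snd H)].

Definition rg_basis d : set (set (rgraph d)) :=
  [set A | exists (G : rgraph d) (r : nat), A = [set H | rg_iso_balls r G H]].

(* The second vertex must lie in the balls that are compared. *)
Definition bg_basis d : set (set (bigraph d)) :=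
  [set A | exists (G : bigraph d) (r : nat),
     gball G (val (bg_fst G)) r (val (bg_snd G)) /\
     A = [set H | bg_iso_balls r G H]].

Section inhabitants.
Variable d : nat.

Let K1 : graph nat := Graph [set 0%N] (fun _ _ => false).

Let K1_simple : simple_graph K1. Proof. by split. Qed.

Let K1_connected : connected_graph K1.
Proof. by move=> x y /= -> ->; exists [::]. Qed.

Let K1_degree : degree_le d K1.
Proof.
move=> x _; rewrite (_ : neighbors K1 x = set0) ?card_ge0//.
by apply/seteqP; split.
Qed.

Let K1c : cgraph d := CGraph K1_simple K1_connected K1_degree.

Let K1v : vertex K1c := SigSub (mem_set (erefl : gvert K1c 0%N)).

Definition rgraph_point : rgraph d := RGraph K1v.
Definition bigraph_point : bigraph d := BiGraph K1v K1v.

End inhabitants.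

HB.instance Definition _ d := Choice.copy (rgraph d) {classic rgraph d}.
HB.instance Definition _ d := isPointed.Build (rgraph d) (rgraph_point d).
HB.instance Definition _ d := Choice.copy (bigraph d) {classic bigraph d}.
HB.instance Definition _ d := isPointed.Build (bigraph d) (bigraph_point d).

Notation rooted_graphs d := (g_sigma_algebraType (@rg_basis d)).
Notation birooted_graphs d := (g_sigma_algebraType (@bg_basis d)).

(* A random rooted graph is identified with its law. *)
Section unimodular.
Context {R : realType} {d : nat}.
Local Open Scope ereal_scope.

Definition unimodular (mu : probability (rooted_graphs d) R) : Prop :=
  forall F : birooted_graphs d -> \bar R,
    measurable_fun setT F -> (forall t, 0 <= F t) ->
    let outgoing := \int[mu]_(G in setT)
      \esum_(x in [set: vertex (G : rgraph d)]) F (BiGraph (rg_root G) x) in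
    let incoming := \int[mu]_(G in setT)
      \esum_(x in [set: vertex (G : rgraph d)]) F (BiGraph x (rg_root G)) in
    outgoing < +oo \/ incoming < +oo -> outgoing = incoming.

Definition unimodular_random_tree (mu : probability (rooted_graphs d) R) :
    Prop :=
  unimodular mu /\ {ae mu, forall G, acyclic_graph (G : rgraph d)}.

End unimodular.

(* An edge configuration is the symmetric relation "{x, y} is in the subset". *)
Definition edge_cylinders (V : Type) : set (set (V -> V -> bool)) :=
  [set A | exists x y, A = [set S : V -> V -> bool | S x y]].

Notation edge_config V := (g_sigma_algebraType (@edge_cylinders V)).

Definition automorphism V (G : graph V) (phi : V -> V) : Prop :=
  graph_iso G G phi.

Definition relabel V (phi : V -> V) (S : V -> V -> bool) : V -> V -> bool :=
  fun x y => S (phi x) (phi y).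

Definition component (V : Type) (S : rel V) (o : V) : set V :=
  [set y | exists p : seq V, path S o p /\ last o p = y].

Definition perc_cluster (V : Type) (S : rel V) (o : V) : graph V :=
  induced (Graph setT S) (component S o).

Section percolation.
Context {R : realType} {dO : measure_display} {Omega : measurableType dO}.
Variables (P : probability Omega R) (V : Type).

Definition invariant_edge_percolation (T : graph V)
    (E : Omega -> V -> V -> bool) : Prop :=
  [/\ forall w, symmetric (E w) /\ subrel (E w) (gedge T),
      measurable_fun setT (E : Omega -> edge_config V) &
      forall phi, automorphism T phi ->
      forall A : set (edge_config V), measurable A ->
        P [set w | A (relabel phi (E w))] = P [set w | A (E w)]].

(* The isomorphism class of the cluster of o is distributed as mu; measurable
   sets of rooted graphs being unions of isomorphism classes, the event below
   says that the class of the cluster belongs to A. *)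
Definition cluster_has_law d (E : Omega -> V -> V -> bool) (o : V)
    (mu : probability (rooted_graphs d) R) : Prop :=
  forall A : set (rooted_graphs d), measurable A ->
    P [set w | exists2 G : rgraph d, A G &
         exists f : nat -> V, graph_iso G (perc_cluster (E w) o) f /\
                              f (val (rg_root G)) = o] = mu A.

End percolation.

Section walks.
Context {R : realType} {dW : measure_display} {W : measurableType dW}.
Variables (Q : probability W R) (V : eqType).

Definition lazy_step (d : nat) (T : graph V) (x y : V) : R :=
  if x == y then 2^-1 else if gedge T x y then (2 * d%:R)^-1 else 0.

Definition simple_step (d : nat) (T : graph V) (x y : V) : R :=
  if gedge T x y then d%:R^-1 else 0.

Definition markov_chain (step : V -> V -> R) (o : V) (X : nat -> W -> V) :
    Prop :=
  (forall n x, measurable [set w | X n w = x]) /\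
  forall (n : nat) (x : nat -> V),
    Q [set w | forall i, (i <= n)%N -> X i w = x i] =
    ((x 0%N == o)%:R * \prod_(i < n) step (x i) (x i.+1))%:E.

Definition sampling_seq (X : nat -> W -> V) (C : set V) : nat -> R :=
  fun n => fine (Q [set w | C (X (2 * n)%N w)]) `^ ((2 * n)%:R)^-1.

Definition sampling_exponent (X : nat -> W -> V) (C : set V) : R :=
  limn (sampling_seq X C).

End walks.

(* The value for the simple walk.  The lazy kernel is (1 + simple kernel) / 2,
   so the value for the lazy walk is the image of this one by
   t |-> (1 + t) / 2; the two differ unless t = 1. *)
Definition cospectral_value {R : realType} (d : nat) (gamma : R) : R :=
  let s := Num.sqrt (d%:R - 1) in
  if 2^-1 * ln (d%:R - 1) <= gamma
  then s / d%:R * (expR gamma / s + s / expR gamma)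
  else 2 * s / d%:R.

(* Main.v *)
Require Import Defs.
From HB Require Import structures.
From mathcomp Require Import all_boot all_order all_algebra.
From mathcomp Require Import finmap.
From mathcomp Require Import all_classical all_reals all_analysis.
From mathcomp Require Import measurable_realfun.
From mathcomp Require Import zify lra.

Set Implicit Arguments.
Unset Strict Implicit.
Unset Printing Implicit Defensive.

Import Order.TTheory GRing.Theory Num.Theory.
Import numFieldNormedType.Exports.

Local Open Scope classical_set_scope.
Local Open Scope ring_scope.

(** The exponent is a deterministic function of the growth of the cluster.

    Let q n k be the probability that a walk on the d-regular tree is, after n
    steps, at a given vertex at distance k from its start.  If the cluster C of
    the root has s k vertices at distance k (distances in C and in the tree
    agree, because C is a subtree), the walk is in C after n steps with
    probability S n, the sum of s k * q n k over k ([sampling_cluster]).  Write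
    m = d - 1 and let a be the holding probability, 0 for the simple walk and
    1/2 for the lazy one.

    If s k is replaced by h ^ k with h >= sqrt m, the sum is
    (a + (1 - a) (h + m / h) / d) ^ n up to a polynomial factor.  Indeed the
    operator of the walk on radial functions is self-adjoint for the sphere
    sizes N k, and it has an eigenfunction phi for that eigenvalue, with
    phi 0 = 1, such that N k * phi k lies between h ^ k and (k + 1) h ^ k
    ([weighted_mass_le], [weighted_mass_ge]).

    Let g be the growth of C.  For h > max(g, sqrt m) the spheres satisfy
    s k <= c h ^ k, which bounds S n from above.  For the lower bound when
    g <= sqrt m it is enough to count the returns to the root, whose probability
    has the rate of h = sqrt m ([radial_law_return_ge]).  When g > sqrt m, take
    sqrt m <= h < g.  The balls of C then have at least c h ^ k vertices; since
    q n k decreases along each parity class of k, and a positive fraction of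
    every ball is at distances of the parity of its radius, every term
    h ^ k * q n k is at most a constant times S n ([sampled_mass_lower]).
    Letting h tend to max(g, sqrt m) gives the rate of S n
    ([sampled_mass_root]), and g = e ^ gamma turns it into the two cases of the
    formula ([cospectral_valueE]).

    It remains to see that the cluster almost surely has a growth.  This is
    known for the random rooted graph with the law of the cluster.  The event
    that the cluster is isomorphic to a member of a measurable set of rooted
    graphs is measurable in the percolation space, because the basic sets of
    rooted graphs translate into conditions on finitely many edges; hence the
    equality of laws transports almost sure statements ([cluster_ae]). *)

(** * The radial law of the walk *)

Section radial.
Variables (R : realType) (m a : R).

(** The mean over the neighbours of a vertex at distance k from the origin: the
    origin sees only vertices at distance 1, and a vertex at distance j + 1 has
    one neighbour at distance j and m neighbours at distance j + 2. *)
Definition radial_mean (f : nat -> R) (k : nat) : R :=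
  if k is j.+1 then (f j + m * f j.+2) / (m + 1) else f 1%N.

(** One step of the walk that stays in place with probability [a]. *)
Definition radial_op (f : nat -> R) (k : nat) : R :=
  a * f k + (1 - a) * radial_mean f k.

(** The probability of being, after n steps, at a given vertex at distance k
    from the starting point. *)
Definition radial_law (n : nat) : nat -> R :=
  iter n radial_op (fun k => (k == 0%N)%:R).

(** The number of vertices at distance k; these weights make [radial_op]
    self-adjoint. *)
Definition sphere_size (k : nat) : R :=
  if k is j.+1 then (m + 1) * m ^+ j else 1.

(** The parameter [h] is a sphere growth rate; [h] and [m / h] give the same
    eigenvalue, and [h = sqrt m] gives the spectral radius of the tree. *)
Definition tree_eigenvalue (h : R) : R := (h + m / h) / (m + 1).

Definition walk_eigenvalue (h : R) : R := a + (1 - a) * tree_eigenvalue h.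

(** The spherical function, i.e. the radial eigenfunction with value 1 at the
    origin.  The eigenvalue equation is a second-order recursion with
    characteristic roots [h / m] and [1 / h]; dividing out the root [1 / h]
    leaves this first-order recursion, which suits inductive bounds. *)
Fixpoint spherical (h : R) (k : nat) : R :=
  if k is j.+1 then spherical h j / h + (h / m) ^+ j * ((h - h^-1) / (m + 1))
  else 1.

(** The mass sampled from a tree with [h ^+ k] vertices at distance k. *)
Definition weighted_mass (h : R) (n : nat) : R :=
  \sum_(k < n.+1) h ^+ k * radial_law n k.

Hypotheses (m_ge1 : 1 <= m) (a_ge0 : 0 <= a) (a_le1 : a <= 1).

Lemma radial_law_ge0 n k : 0 <= radial_law n k.
Proof.
have m1 := m_ge1; have a1 := a_le1.
elim: n k => [|n IH] k; first by rewrite /= ler0n.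
rewrite /radial_law iterS -/(radial_law n) /radial_op.
apply: addr_ge0; first exact: mulr_ge0.
apply: mulr_ge0; first lra.
case: k => [|k] //=; apply: divr_ge0; last lra.
apply: addr_ge0 => //; apply: mulr_ge0 => //; lra.
Qed.

Lemma radial_law_supp n k : (n < k)%N -> radial_law n k = 0.
Proof.
elim: n k => [|n IH] [|k]//=; rewrite ltnS => nk.
rewrite -/(radial_law n) /radial_op /= (IH _ nk) (IH _ (leqW nk)).
by rewrite (IH _ (leqW (leqW nk))) !(mulr0, addr0, mul0r).
Qed.

(** Monotonicity holds only in steps of two: the simple walk cannot be at a
    distance of the wrong parity. *)
Lemma radial_law_anti2 n k : radial_law n k.+2 <= radial_law n k.
Proof.
have m1 := m_ge1; have a1 := a_le1.
elim: n k => [|n IH] k; first by rewrite /= ler0n.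
rewrite /radial_law iterS -/(radial_law n) /radial_op.
apply: lerD; first exact: ler_wpM2l.
apply: ler_wpM2l; first lra.
have main x y z w : x <= z -> y <= w ->
    (x + m * y) / (m + 1) <= (z + m * w) / (m + 1).
  move=> xz yw; rewrite ler_pM2r ?invr_gt0; last lra.
  by apply: lerD => //; apply: ler_wpM2l => //; lra.
case: k => [|k] /=; last exact: main.
apply: le_trans (main _ _ _ _ (lexx _) (IH 1%N)) _.
by rewrite -[X in X + _]mul1r -mulrDl addrC mulrAC mulfV ?mul1r//; lra.
Qed.

Lemma sphere_size_gt0 k : 0 < sphere_size k.
Proof.
have m1 := m_ge1.
by case: k => [|k] //=; rewrite mulr_gt0 ?exprn_gt0//; lra.
Qed.

Lemma sphere_size_ge k : m ^+ k <= sphere_size k.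
Proof.
have m1 := m_ge1.
case: k => [|k] /=; first by rewrite expr0.
by rewrite exprS ler_wpM2r ?exprn_ge0//; lra.
Qed.

(** The pairing of a mean with [g], as a sum over edges: an edge between the
    spheres k and k + 1 is counted from both ends.  Up to the boundary term the right-hand
    side is symmetric in [f] and [g]. *)
Lemma radial_meanM (f g : nat -> R) K :
  \sum_(k < K.+1) sphere_size k * radial_mean f k * g k =
  \sum_(k < K) m ^+ k * f k * g k.+1 + \sum_(k < K.+1) m ^+ k * f k.+1 * g k.
Proof.
have m1 := m_ge1.
rewrite big_ord_recl [X in _ = _ + X]big_ord_recl [sphere_size _]/= ?expr0 !mul1r.
rewrite addrCA; congr (_ + _); rewrite -big_split /=; apply: eq_bigr => i _.
rewrite /bump /= add1n exprS.
have d0 : (m + 1) * (m + 1)^-1 = 1 by rewrite mulfV//; lra.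
transitivity ((m + 1) * (m + 1)^-1 *
  (m ^+ i * (f i + m * f i.+2) * g i.+1)); first lra.
by rewrite d0; lra.
Qed.

Lemma radial_op_sym (f g : nat -> R) K : f K = 0 -> f K.+1 = 0 ->
  \sum_(k < K.+1) sphere_size k * radial_op f k * g k =
  \sum_(k < K.+1) sphere_size k * f k * radial_op g k.
Proof.
move=> fK fK1.
have E1 (u v : nat -> R) : \sum_(k < K.+1) sphere_size k * radial_op u k * v k =
   a * \sum_(k < K.+1) sphere_size k * u k * v k +
   (1 - a) * \sum_(k < K.+1) sphere_size k * radial_mean u k * v k.
  by rewrite !mulr_sumr -big_split /=; apply: eq_bigr => i _; rewrite /radial_op; lra.
rewrite E1.
under [RHS]eq_bigr do rewrite -mulrA [f _ * _]mulrC mulrA.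
rewrite E1; congr (_ + _); last congr (_ * _).
  by congr (_ * _); apply: eq_bigr => i _; lra.
rewrite !radial_meanM !big_ord_recr /= fK fK1 !(mulr0, mul0r, addr0).
by rewrite addrC; congr (_ + _); apply: eq_bigr => i _; lra.
Qed.

(** Self-adjointness moves the n steps from the point mass at the origin, where
    the walk starts, to the test function. *)
Lemma radial_law_dual n (g : nat -> R) K : (n <= K)%N ->
  \sum_(k < K.+1) sphere_size k * radial_law n k * g k = iter n radial_op g 0%N.
Proof.
elim: n g => [|n IH] g nK.
  rewrite big_ord_recl /= !mul1r big1 ?addr0// => i _.
  by rewrite /= mulr0 mul0r.
rewrite {1}/radial_law iterS -/(radial_law n) radial_op_sym.
- by rewrite IH 1?ltnW// iterSr.
- exact: radial_law_supp.
- by rewrite radial_law_supp// ltnW.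
Qed.

(** A walk can return at time 2n by being on sphere k at time n; the paths from
    and to the origin have the same probability. *)
Lemma radial_law_return n k :
  sphere_size k * radial_law n k ^+ 2 <= radial_law (n + n) 0.
Proof.
have [kn|nk] := leqP k n; last first.
  by rewrite radial_law_supp// expr0n mulr0 radial_law_ge0.
rewrite {2}/radial_law iterD -/(radial_law n) -(radial_law_dual _ (leqnn n)).
rewrite (bigD1 (Ordinal (kn : (k < n.+1)%N))) //= expr2 mulrA lerDl.
apply: sumr_ge0 => i _; rewrite mulr_ge0 ?radial_law_ge0// mulr_ge0 ?radial_law_ge0//.
exact/ltW/sphere_size_gt0.
Qed.

Lemma radial_op_spherical h k : 0 < h ->
  radial_op (spherical h) k = walk_eigenvalue h * spherical h k.
Proof.
move=> h0; have m1 := m_ge1.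
have m0 : m * m^-1 = 1 by rewrite mulfV//; lra.
have d0 : (m + 1) * (m + 1)^-1 = 1 by rewrite mulfV//; lra.
have hn : h * h^-1 = 1 by rewrite mulfV//; lra.
rewrite /radial_op /walk_eigenvalue [(a + _) * _]mulrDl -[(1 - a) * _ * _]mulrA.
congr (_ + _ * _); rewrite /tree_eigenvalue.
case: k => [|k] /=.
  rewrite !mulr1 !mul1r; move: d0; set c := (m + 1)^-1 => d0.
  have := congr1 ( *%R h^-1) d0; lra.
rewrite exprS; move: (spherical h k) ((h / m) ^+ k) => s t.
move: d0; set c := (m + 1)^-1; move: h^-1 m^-1 hn m0 => hi mi hn m0 d0.
have := congr1 ( *%R (c * s)) hn.
have := congr1 ( *%R (c * (h * t * (h - hi) * c))) m0.
lra.
Qed.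

Lemma iter_radial_op_spherical h n : 0 < h ->
  iter n radial_op (spherical h) 0 = walk_eigenvalue h ^+ n.
Proof.
move=> h0.
suff -> : iter n radial_op (spherical h) =
    fun k => walk_eigenvalue h ^+ n * spherical h k by rewrite /= mulr1.
elim: n => [|n IH]; first by apply/funext => k; rewrite /= expr0 mul1r.
apply/funext => k; rewrite iterS IH exprSr -mulrA -radial_op_spherical//.
by rewrite /radial_op /radial_mean; case: k => [|k] /=; lra.
Qed.

Lemma sphere_spherical1 h : 0 < h ->
  sphere_size 1 * spherical h 1 = h + m / h.
Proof.
have m1 := m_ge1.
move=> h0; rewrite /= !(expr0, mul1r, mulr1) mulrDr.
by rewrite mulrCA mulfV ?mulr1 ?mulrDl ?mul1r//; lra.
Qed.

(** The recursion for the eigenfunction of the transposed operator; both of the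
    bounds below are read off from it. *)
Lemma sphere_sphericalSS h k : 0 < h ->
  sphere_size k.+2 * spherical h k.+2 =
  (m / h) * (sphere_size k.+1 * spherical h k.+1) + h ^+ k.+2 - h ^+ k.
Proof.
have m1 := m_ge1.
move=> h0.
have hk : (h / m) ^+ k.+1 * m ^+ k.+1 = h ^+ k.+1.
  by rewrite -exprMn divfK//; lra.
have -> : h ^+ k = h^-1 * h ^+ k.+1 by rewrite exprS mulrA mulVf ?mul1r//; lra.
have -> : spherical h k.+2 =
  spherical h k.+1 / h + (h / m) ^+ k.+1 * ((h - h^-1) / (m + 1)) by [].
rewrite [h ^+ k.+2]exprS -hk /sphere_size.
move: (spherical h k.+1) ((h / m) ^+ k.+1) => s t; rewrite exprS.
have d0 : (m + 1) * (m + 1)^-1 = 1 by rewrite mulfV//; lra.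
transitivity (m * m ^+ k * ((m + 1) * s / h) +
   m * m ^+ k * (t * (h - h^-1) * ((m + 1) * (m + 1)^-1))); first lra.
by rewrite d0; lra.
Qed.

Lemma spherical_ge h k : 1 <= h -> h ^+ k <= sphere_size k * spherical h k.
Proof.
have m1 := m_ge1.
move=> h1; have h0 : 0 < h by lra.
have mh0 : 0 <= m / h by apply: divr_ge0; lra.
case: k => [|k]; first by rewrite /= mulr1 expr0.
elim: k => [|k IH]; first by rewrite sphere_spherical1// expr1; lra.
rewrite sphere_sphericalSS//.
suff : h ^+ k <= m / h * (sphere_size k.+1 * spherical h k.+1) by lra.
apply: (@le_trans _ _ (m / h * h ^+ k.+1)); last exact: ler_wpM2l.
rewrite exprS mulrA divfK ?gt_eqF// ler_peMl// exprn_ge0//; lra.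
Qed.

(** Since [m / h <= h], each step of the recursion adds at most one more
    [h ^+ k].  The linear factor reflects the double root of the eigenvalue
    equation at [h = sqrt m]. *)
Lemma spherical_le h k : 1 <= h -> m <= h ^+ 2 ->
  sphere_size k * spherical h k <= k.+1%:R * h ^+ k.
Proof.
have m1 := m_ge1.
move=> h1 mh; have h0 : 0 < h by lra.
case: k => [|k]; first by rewrite /= !mulr1.
have mhh : m / h <= h by rewrite ler_pdivrMr// -expr2.
elim: k => [|k IH]; first by rewrite sphere_spherical1// expr1; lra.
rewrite sphere_sphericalSS//.
have hk0 : 0 <= h ^+ k by rewrite exprn_ge0// ltW.
suff : m / h * (sphere_size k.+1 * spherical h k.+1) <= k.+2%:R * h ^+ k.+2.
  move=> H; rewrite -[k.+3%:R]natr1 [(k.+2%:R + 1) * _]mulrDl mul1r.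
  apply: (@le_trans _ _ (m / h * (sphere_size k.+1 * spherical h k.+1) + h ^+ k.+2)).
    by rewrite gerBl.
  by rewrite lerD2r.
apply: le_trans (ler_wpM2l _ IH) _; first by apply: divr_ge0; lra.
rewrite mulrCA; apply: ler_wpM2l => //.
by rewrite [h ^+ k.+2]exprS; apply: ler_wpM2r => //; rewrite exprn_ge0// ltW.
Qed.

Lemma weighted_mass_le h n : 1 <= h ->
  weighted_mass h n <= walk_eigenvalue h ^+ n.
Proof.
move=> h1; have h0 : 0 < h by lra.
rewrite -iter_radial_op_spherical// -(radial_law_dual _ (leqnn n)).
apply: ler_sum => k _; rewrite mulrAC; apply: ler_wpM2r; first exact: radial_law_ge0.
exact: spherical_ge.
Qed.

Lemma weighted_mass_ge h n : 1 <= h -> m <= h ^+ 2 ->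
  walk_eigenvalue h ^+ n <= n.+1%:R * weighted_mass h n.
Proof.
move=> h1 mh; have h0 : 0 < h by lra.
rewrite -iter_radial_op_spherical// -(radial_law_dual _ (leqnn n)).
rewrite mulr_sumr; apply: ler_sum => k _; rewrite mulrAC mulrA.
apply: ler_wpM2r; first exact: radial_law_ge0.
apply: le_trans (spherical_le _ _ _) _ => //.
apply: ler_wpM2r; first by rewrite exprn_ge0// ltW.
by rewrite ler_nat; exact: ltn_ord.
Qed.

Lemma walk_eigenvalue_ge0 h : 1 <= h -> 0 <= walk_eigenvalue h.
Proof.
have m1 := m_ge1; have a1 := a_le1 => h1.
rewrite addr_ge0// mulr_ge0; [by []|lra|apply: divr_ge0; last lra].
by rewrite addr_ge0 ?divr_ge0//; lra.
Qed.

(** Kesten's lower bound for the return probability: at [h = sqrt m] each of the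
    n + 1 terms of [weighted_mass h n] is at most the square root of the return
    probability at time 2n, by [radial_law_return]. *)
Lemma radial_law_return_ge n h : 1 <= h -> h ^+ 2 = m ->
  walk_eigenvalue h ^+ (n + n) <= n.+1%:R ^+ 4 * radial_law (n + n) 0.
Proof.
move=> h1 hm; have hmle : m <= h ^+ 2 by rewrite hm.
set q := radial_law (n + n) 0; have q0 : 0 <= q by exact: radial_law_ge0.
have h0 : 0 <= h by apply: le_trans h1.
have term k : h ^+ k * radial_law n k <= Num.sqrt q.
  have t0 : 0 <= h ^+ k * radial_law n k by rewrite mulr_ge0 ?exprn_ge0 ?radial_law_ge0.
  rewrite -[leLHS]ger0_norm// -sqrtr_sqr ler_wsqrtr// exprMn -exprM mulnC exprM hm.
  apply: le_trans (radial_law_return n k); apply: ler_wpM2r; first exact: sqr_ge0.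
  exact: sphere_size_ge.
have mass : weighted_mass h n <= n.+1%:R * Num.sqrt q.
  apply: le_trans (ler_sum _ (fun (k : 'I_n.+1) _ => term k)) _.
  by rewrite sumr_const card_ord mulr_natl.
have main : walk_eigenvalue h ^+ n <= n.+1%:R * (n.+1%:R * Num.sqrt q).
  by apply: le_trans (weighted_mass_ge _ _ _) _ => //; rewrite ler_wpM2l.
have q4 : n.+1%:R ^+ 4 * q = (n.+1%:R * (n.+1%:R * Num.sqrt q)) ^+ 2.
  by rewrite !exprMn sqr_sqrtr// mulrA -exprD.
rewrite q4 exprD -expr2 lerXn2r// nnegrE ?mulr_ge0 ?sqrtr_ge0//.
by rewrite exprn_ge0// walk_eigenvalue_ge0.
Qed.

End radial.


(** * Exponential rates of sequences *)

Section eventually.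
Variable R : realType.
Implicit Types x y z c : R.

Lemma expr_dominated x y c : 0 < x -> x < y -> 0 < c ->
  \forall n \near \oo, x ^+ n <= c * y ^+ n.
Proof.
move=> x0 xy c0; have y0 : 0 < y by apply: lt_trans xy.
have : (fun n => (x / y) ^+ n) @ \oo --> (0 : R).
  by apply: cvg_expr; rewrite ger0_norm ?divr_ge0// ?ltW// ltr_pdivrMr// mul1r.
move=> /cvgr_lt /(_ _ c0); apply: filterS => n /ltW.
by rewrite expr_div_n ler_pdivrMr// exprn_gt0.
Qed.

Lemma bernoulli (t : R) n : 0 <= t -> 1 + n%:R * t <= (1 + t) ^+ n.
Proof.
move=> t0; elim: n => [|n IH]; first by rewrite mul0r addr0 expr0.
rewrite exprS; apply: (@le_trans _ _ ((1 + t) * (1 + n%:R * t))).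
  rewrite -natr1; have : 0 <= n%:R * t * t by rewrite !mulr_ge0.
  by lra.
by apply: ler_wpM2l => //; lra.
Qed.

Lemma nat_expr_dominated x y c : 0 < x -> x < y -> 0 < c ->
  \forall n \near \oo, n.+1%:R * x ^+ n <= c * y ^+ n.
Proof.
move=> x0 xy c0; pose z := (x + y) / 2.
have xz : x < z by rewrite /z; lra.
have zy : z < y by rewrite /z; lra.
have z0 : 0 < z by lra.
pose t := z / x - 1; have t0 : 0 < t by rewrite subr_gt0 ltr_pdivlMr// mul1r.
pose e := Num.min 1 t; have e0 : 0 < e by rewrite lt_min ltr01.
have bd n : n.+1%:R * x ^+ n <= e^-1 * z ^+ n.
  rewrite ler_pdivlMl// mulrA -ler_pdivlMr ?exprn_gt0// -expr_div_n.
  rewrite -[z / x](addrNK 1) -/t addrC.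
  apply: le_trans (bernoulli n (ltW t0)).
  have e1 : e <= 1 by rewrite ge_min lexx.
  have et : n%:R * e <= n%:R * t by rewrite ler_wpM2l// ge_min lexx orbT.
  by rewrite -natr1; lra.
have := expr_dominated z0 zy (mulr_gt0 e0 c0); apply: filterS => n zn.
by apply: le_trans (bd n) _; rewrite ler_pdivrMl// mulrA.
Qed.

(** Polynomial factors and constants are absorbed by an arbitrarily small change
    of the base, so only rates need to be compared afterwards. *)
Lemma poly_expr_dominated p x y c : 0 < x -> x < y -> 0 < c ->
  \forall n \near \oo, n.+1%:R ^+ p * x ^+ n <= c * y ^+ n.
Proof.
elim: p x y c => [|p IH] x y c x0 xy c0.
  have := expr_dominated x0 xy c0; apply: filterS => n.
  by rewrite expr0 mul1r.
pose z := (x + y) / 2.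
have xz : x < z by rewrite /z; lra.
have zy : z < y by rewrite /z; lra.
have z0 : 0 < z by lra.
have := nat_expr_dominated z0 zy c0; have := IH _ _ _ x0 xz ltr01.
apply: filterS2 => n h1 h2; apply: le_trans h2.
by rewrite exprS -mulrA ler_wpM2l//; rewrite mul1r in h1.
Qed.

Lemma powR_invn_expr x n : 0 <= x -> (0 < n)%N -> (x ^+ n) `^ (n%:R)^-1 = x.
Proof.
move=> x0 n0; rewrite -powR_mulrn// -powRrM mulfV ?powRr1//.
by rewrite pnatr_eq0 -lt0n.
Qed.

Lemma powR_invnK x n : 0 <= x -> (0 < n)%N -> (x `^ (n%:R)^-1) ^+ n = x.
Proof.
move=> x0 n0; rewrite -powR_mulrn ?powR_ge0// -powRrM mulVf ?powRr1//.
by rewrite pnatr_eq0 -lt0n.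
Qed.

(** Comparing with exact powers of every [x < l] and [y > l] avoids computing
    the roots of constants and of polynomial factors. *)
Lemma cvg_root_sandwich (k : nat -> nat) (u : nat -> R) (l : R) :
  (forall n, (n <= k n)%N) -> 0 < l ->
  (forall x, 0 < x -> x < l -> \forall n \near \oo, x ^+ k n <= u n) ->
  (forall y, l < y -> \forall n \near \oo, u n <= y ^+ k n) ->
  (fun n => u n `^ ((k n)%:R)^-1) @ \oo --> l.
Proof.
move=> kn l0 lo up; apply/cvgrPdist_le => e e0.
pose x := Num.max (l / 2) (l - e); pose y := l + e.
have x0 : 0 < x by rewrite lt_max divr_gt0.
have xl : x < l by rewrite gt_max; apply/andP; split; lra.
have ly : l < y by rewrite /y; lra.
have := lo _ x0 xl; have := up _ ly; have := nbhs_infty_gt 0.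
apply: filterS3 => n n0 uy xu.
have k0 : (0 < k n)%N by apply: leq_trans n0 (kn n).
have u0 : 0 <= u n by apply: le_trans xu; rewrite exprn_ge0// ltW.
have inv0 : 0 <= (k n)%:R^-1 :> R by rewrite invr_ge0.
have h1 : x <= u n `^ ((k n)%:R)^-1.
  rewrite -[leLHS](powR_invn_expr (ltW x0) k0) ge0_ler_powR// nnegrE//.
  by rewrite exprn_ge0// ltW.
have h2 : u n `^ ((k n)%:R)^-1 <= y.
  rewrite -[leRHS](powR_invn_expr _ k0); last by lra.
  rewrite ge0_ler_powR// nnegrE// exprn_ge0//; lra.
have h3 : l - e <= x by rewrite le_max lexx orbT.
by rewrite ler_norml; apply/andP; split; rewrite /y in h2; lra.
Qed.

(** The finitely many exceptional indices are paid for by the constant. *)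
Lemma expr_bound_all (u : nat -> R) h : 0 < h -> (forall n, 0 <= u n) ->
  (\forall n \near \oo, u n <= h ^+ n) ->
  exists2 C, 0 < C & forall n, u n <= C * h ^+ n.
Proof.
move=> h0 u0 [N _ uN]; pose C := 1 + \sum_(i < N) u i / h ^+ i.
have t0 i : 0 <= u i / h ^+ i by rewrite divr_ge0// exprn_ge0// ltW.
have S0 : 0 <= \sum_(i < N) u i / h ^+ i by exact: sumr_ge0.
exists C; first by rewrite /C; lra.
move=> n; rewrite -ler_pdivrMr ?exprn_gt0//; have [nN|Nn] := ltnP n N.
  rewrite /C (bigD1 (Ordinal nN)) //= addrCA lerDl addr_ge0//.
  exact: sumr_ge0.
apply: (@le_trans _ _ 1); last by rewrite /C lerDl.
by rewrite ler_pdivrMr ?exprn_gt0// mul1r; exact: uN.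
Qed.

Lemma growth_upper (b : nat -> R) g h : (forall n, 1 <= b n) ->
  (fun n => b n `^ (n%:R)^-1) @ \oo --> g -> g < h -> 0 < h ->
  exists2 C, 0 < C & forall n, b n <= C * h ^+ n.
Proof.
move=> b1 bg gh h0; apply: expr_bound_all => // [n|].
  by apply: le_trans (b1 n).
have := nbhs_infty_gt 0; move/cvgr_lt: bg => /(_ _ gh).
apply: filterS2 => n bh n0; have b0 : 0 <= b n by apply: le_trans (b1 n).
by rewrite -[leLHS](powR_invnK b0 n0) lerXn2r// ?nnegrE ?powR_ge0// ltW.
Qed.

Lemma growth_lower (b : nat -> R) g h : (forall n, 1 <= b n) ->
  (fun n => b n `^ (n%:R)^-1) @ \oo --> g -> h < g -> 0 < h ->
  exists2 c, 0 < c & forall n, c * h ^+ n <= b n.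
Proof.
move=> b1 bg hg h0; have b0 n : 0 < b n by apply: lt_le_trans (b1 n).
have hi0 : 0 < h^-1 by rewrite invr_gt0.
have bi0 n : 0 <= (b n)^-1 by rewrite invr_ge0 ltW.
have ev : \forall n \near \oo, (b n)^-1 <= h^-1 ^+ n.
  have := nbhs_infty_gt 0; move/cvgr_gt: bg => /(_ _ hg).
  apply: filterS2 => n bh n0.
  rewrite exprVn lef_pV2 ?posrE ?exprn_gt0//.
  by rewrite -[leRHS](powR_invnK (ltW (b0 n)) n0) lerXn2r// ?nnegrE ?powR_ge0// ltW.
have [C C0 bC] := expr_bound_all hi0 bi0 ev.
exists C^-1; first by rewrite invr_gt0.
move=> n; have := bC n; rewrite exprVn ler_pdivlMr ?exprn_gt0//.
by rewrite ler_pdivrMl// ler_pdivrMl// mulrC.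
Qed.

Lemma growth_ge1 (b : nat -> R) (g : R) : (forall n, 1 <= b n) ->
  (fun n => b n `^ (n%:R)^-1) @ \oo --> g -> 1 <= g.
Proof.
move=> b1 bg; apply: (cvgr_to_ge bg); apply: nearW => n.
apply: (@le_trans _ _ (1 `^ (n%:R)^-1)); first by rewrite powR1.
by apply: ge0_ler_powR; rewrite ?nnegrE// (le_trans _ (b1 n)).
Qed.

End eventually.

(** * Sampling a tree with given sphere sizes *)

Section sampling.
Variables (R : realType) (m a : R) (d : nat) (s : nat -> nat).
Hypotheses (m_ge1 : 1 <= m) (a_ge0 : 0 <= a) (a_le1 : a <= 1).
Hypothesis s0 : s 0 = 1%N.
Hypothesis sS : forall k, (s k.+1 <= d * s k)%N.

Let q := radial_law m a.

Definition sampled_mass (n : nat) : R := \sum_(k < n.+1) (s k)%:R * q n k.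

Fixpoint parity_sum (k : nat) : nat :=
  if k is j.+2 then parity_sum j + s j.+2 else s k.

Let q_ge0 n k : 0 <= q n k. Proof. exact: radial_law_ge0. Qed.

(** Along a parity class [q n] decreases, so [q n k] is the smallest of the
    weights of the spheres that are summed. *)
Lemma parity_sum_mass n k :
  (parity_sum k)%:R * q n k <= \sum_(j < k.+1) (s j)%:R * q n j.
Proof.
suff : (parity_sum k)%:R * q n k <= \sum_(j < k.+1) (s j)%:R * q n j /\
  (parity_sum k.+1)%:R * q n k.+1 <= \sum_(j < k.+2) (s j)%:R * q n j by case.
elim: k => [|k [IH1 IH2]].
  by rewrite !big_ord_recr !big_ord0 /= !add0r lerDr mulr_ge0.
split=> //; rewrite big_ord_recr /= natrD mulrDl lerD2r.
apply: le_trans (ler_wpM2l _ (radial_law_anti2 m_ge1 a_ge0 a_le1 n k)) _ => //.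
by apply: le_trans IH1 _; rewrite [leRHS]big_ord_recr /= lerDl mulr_ge0.
Qed.

(** Each sphere of the wrong parity has at most d times as many vertices as the
    preceding one.  When k is odd the origin has no predecessor, and it is
    compared with the first sphere: this is where [0 < s 1] enters. *)
Lemma ball_parity_sum k : (0 < s 1)%N ->
  (\sum_(j < k.+1) s j <= d.+2 * parity_sum k)%N.
Proof.
move=> s1.
(* The next sphere is added to the ball to make the induction go through. *)
suff : (\sum_(j < k.+1) s j + s k.+1 <= d.+2 * parity_sum k)%N /\
  (\sum_(j < k.+2) s j + s k.+2 <= d.+2 * parity_sum k.+1)%N.
  by case=> H _; apply: leq_trans H; exact: leq_addr.
elim: k => [|k [IH1 IH2]].
  rewrite !big_ord_recr !big_ord0 /= !add0n; split.
    by have := sS 0; rewrite s0; lia.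
  by have := sS 1; rewrite s0; lia.
split=> //; rewrite !big_ord_recr /= in IH1 *.
by have := sS k.+2; lia.
Qed.

Lemma sampled_mass_upper C h n : 1 <= h -> (forall k, (s k)%:R <= C * h ^+ k) ->
  0 <= C -> sampled_mass n <= C * walk_eigenvalue m a h ^+ n.
Proof.
move=> h1 sC C0; apply: (@le_trans _ _ (C * weighted_mass m a h n)).
  by rewrite mulr_sumr; apply: ler_sum => k _; rewrite mulrA ler_wpM2r.
by apply: ler_wpM2l => //; exact: weighted_mass_le.
Qed.

Lemma sampled_mass_return n : q n 0 <= sampled_mass n.
Proof.
by rewrite /sampled_mass big_ord_recl /= s0 mul1r lerDl sumr_ge0// => i _; rewrite mulr_ge0.
Qed.

(** Each of the n + 1 terms of [weighted_mass h n] is compared with the whole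
    of [sampled_mass n], by the two parity lemmas. *)
Lemma sampled_mass_lower c h n : 1 <= h -> m <= h ^+ 2 -> (0 < s 1)%N -> 0 < c ->
  (forall k, c * h ^+ k <= (\sum_(j < k.+1) s j)%:R) ->
  c * walk_eigenvalue m a h ^+ n <= n.+1%:R ^+ 2 * (d.+2%:R * sampled_mass n).
Proof.
move=> h1 mh s1 c0 cB.
apply: (@le_trans _ _ (c * (n.+1%:R * weighted_mass m a h n))).
  by rewrite ler_pM2l//; exact: weighted_mass_ge.
rewrite mulrCA expr2 -mulrA; apply: ler_wpM2l => //.
rewrite mulr_sumr.
apply: (@le_trans _ _ (\sum_(k < n.+1) (d.+2%:R * sampled_mass n))); last first.
  by rewrite sumr_const card_ord [leRHS]mulr_natl.
apply: ler_sum => k _; rewrite mulrA.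
apply: le_trans (ler_wpM2r (q_ge0 n k) (cB k)) _.
apply: (@le_trans _ _ ((d.+2 * parity_sum k)%N%:R * q n k)).
  by apply: ler_wpM2r => //; rewrite ler_nat; exact: ball_parity_sum.
rewrite natrM -mulrA; apply: ler_wpM2l => //.
apply: le_trans (parity_sum_mass n k) _.
rewrite /sampled_mass; move: (nat_of_ord k) (ltn_ord k) => j jn.
rewrite -[leRHS](big_mkord xpredT (fun i => (s i)%:R * q n i)).
rewrite (big_cat_nat (leq0n j.+1) jn) /= big_mkord lerDl.
by apply: sumr_ge0 => i _; rewrite mulr_ge0.
Qed.

Lemma ball_size_no_neighbor k : s 1 = 0%N -> (\sum_(j < k.+1) s j)%N = 1%N.
Proof.
move=> s1; rewrite big_ord_recl s0 big1 ?addn0// => i _.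
rewrite lift0; elim: (val i) => [//|j IH].
by have := sS j.+1; rewrite IH muln0 leqn0 => /eqP.
Qed.

Lemma walk_eigenvalue_gt0 h : 0 < h -> 0 < walk_eigenvalue m a h.
Proof.
have m1 := m_ge1; have a0 := a_ge0; have a1 := a_le1 => h0.
have t0 : 0 < tree_eigenvalue m h.
  by apply: divr_gt0; last lra; apply: addr_gt0 => //; apply: divr_gt0 => //; lra.
have [a1'|a1'] := eqVneq a 1; first by rewrite /walk_eigenvalue a1'; lra.
rewrite ltr_wpDl// mulr_gt0// subr_gt0 lt_neqAle a1'; exact: a_le1.
Qed.

(** Gives the continuity of the rate in [h], from both sides. *)
Lemma walk_eigenvalue_lip h l : 0 < l -> l <= h ->
  walk_eigenvalue m a h <= walk_eigenvalue m a l + (h - l).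
Proof.
have m1 := m_ge1; have a0 := a_ge0; have a1 := a_le1 => l0 lh.
have t0 : tree_eigenvalue m h <= tree_eigenvalue m l + (h - l).
  rewrite /tree_eigenvalue ler_pdivrMr; last lra.
  rewrite mulrDl divfK; last lra.
  have : m / h <= m / l by apply: ler_wpM2l; [lra|rewrite lef_pV2// posrE//; lra].
  have : 0 <= m * (h - l) by rewrite mulr_ge0//; lra.
  lra.
have := ler_wpM2l (_ : 0 <= 1 - a) t0.
have := mulr_ge0 a0 (_ : 0 <= h - l).
rewrite /walk_eigenvalue; move: (tree_eigenvalue m h) (tree_eigenvalue m l) => th tl.
move=> /(_ ltac:(lra)) A /(_ ltac:(lra)); lra.
Qed.

Lemma near_double (P : nat -> Prop) :
  (\forall n \near \oo, P n) -> \forall n \near \oo, P (2 * n)%N.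
Proof.
move=> [N _ NP]; exists N => // n /= Nn; apply: NP => /=.
by apply: leq_trans Nn _; rewrite leq_pmull.
Qed.

(** Below [sqrt m] the returns to the origin dominate the spheres, so that the
    growth only matters above it. *)
Theorem sampled_mass_root (g : R) :
  (fun n => (\sum_(j < n.+1) s j)%:R `^ (n%:R)^-1) @ \oo --> g ->
  (fun n => sampled_mass (2 * n) `^ ((2 * n)%:R)^-1) @ \oo -->
  walk_eigenvalue m a (Num.max g (Num.sqrt m)).
Proof.
move=> Bg; set b := fun n => _ in Bg; set G := Num.max _ _.
set l := walk_eigenvalue m a G.
have b1 n : 1 <= (\sum_(j < n.+1) s j)%:R :> R.
  by rewrite ler1n big_ord_recl s0.
have sm1 : 1 <= Num.sqrt m by rewrite -sqrtr1 ler_wsqrtr.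
have smm : Num.sqrt m ^+ 2 = m by rewrite sqr_sqrtr// (le_trans ler01).
have smG : Num.sqrt m <= G by rewrite le_max lexx orbT.
have gG : g <= G by rewrite le_max lexx.
have l0 : 0 < l by apply: walk_eigenvalue_gt0; lra.
apply: (@cvg_root_sandwich _ (fun n => 2 * n)%N) => //.
- by move=> n; rewrite leq_pmull.
- move=> x x0 xl; have [gm|mg] := leP g (Num.sqrt m).
    have Gm : G = Num.sqrt m by apply/max_idPr.
    have x2l : x ^+ 2 < l ^+ 2 by rewrite ltrXn2r// ?nnegrE ltW.
    have := poly_expr_dominated 4 (exprn_gt0 2 x0) x2l ltr01.
    apply: filterS => n; rewrite mul1r -!exprM => H.
    have np : 0 < n.+1%:R ^+ 4 :> R by rewrite exprn_gt0.
    rewrite -(ler_pM2l np); apply: le_trans H _.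
    rewrite /l Gm mul2n -addnn.
    apply: le_trans (radial_law_return_ge m_ge1 a_ge0 a_le1 n sm1 smm) _.
    by apply: ler_wpM2l; [exact: ltW|exact: sampled_mass_return].
  have Gg : G = g by apply/max_idPl/ltW.
  (* By [walk_eigenvalue_lip] the rate at this [h] is still above [x]. *)
  pose h := Num.max (Num.sqrt m) (g - (l - x) / 2).
  have hm : Num.sqrt m <= h by rewrite le_max lexx.
  have hg1 : g - (l - x) / 2 <= h by rewrite le_max lexx orbT.
  have hg : h < g by rewrite gt_max mg /=; lra.
  have h1 : 1 <= h by lra.
  have h0 : 0 < h by lra.
  have mh : m <= h ^+ 2 by rewrite -[leLHS]smm lerXn2r// nnegrE; lra.
  have [c c0 cB] := growth_lower b1 Bg hg h0.
  (* Otherwise the tree is a single vertex and has growth 1. *)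
  have s1 : (0 < s 1)%N.
    rewrite lt0n; apply/negP => /eqP s10.
    have : (fun n => (\sum_(j < n.+1) s j)%:R `^ (n%:R)^-1) @ \oo --> (1 : R).
      under eq_fun do rewrite ball_size_no_neighbor// powR1.
      exact: cvg_cst.
    by move=> /(cvg_unique _ Bg) => /(_ (@norm_hausdorff _ _)) g1; lra.
  have xh : x < walk_eigenvalue m a h.
    have := walk_eigenvalue_lip h0 (ltW hg).
    by rewrite -Gg -/l; lra.
  pose D : R := d.+2%:R; have D0 : 0 < D by [].
  have := poly_expr_dominated 2 x0 xh (divr_gt0 c0 D0).
  move=> /near_double; apply: filterS => n H.
  have := sampled_mass_lower (2 * n) h1 mh s1 c0 cB.
  set N := (2 * n)%N in H *; rewrite -/D => L.
  have np : 0 < N.+1%:R ^+ 2 :> R by rewrite exprn_gt0.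
  rewrite -(ler_pM2l np); apply: le_trans H _.
  by rewrite mulrAC ler_pdivrMr// -mulrA [_ * D]mulrC.
- move=> y ly; pose h := G + (y - l) / 2.
  have h1 : 1 <= h by rewrite /h; lra.
  have gh : g < h by rewrite /h; lra.
  have h0 : 0 < h by lra.
  have [C C0 CB] := growth_upper b1 Bg gh h0.
  have hy : walk_eigenvalue m a h < y.
    have := @walk_eigenvalue_lip h G.
    move=> /(_ ltac:(lra)) /(_ ltac:(rewrite /h; lra)).
    by rewrite -/l /h; lra.
  have Ci : 0 < C^-1 by rewrite invr_gt0.
  have := expr_dominated (walk_eigenvalue_gt0 h0) hy Ci.
  move=> /near_double; apply: filterS => n H.
  apply: le_trans (sampled_mass_upper (2 * n) h1 _ (ltW C0)) _.
    move=> k; apply: le_trans (CB k).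
    by rewrite ler_nat big_ord_recr leq_addl.
  by rewrite -ler_pdivlMl.
Qed.

End sampling.

(** * Distances in a regular tree *)

(** Two simple paths that leave [x] by different edges close up to a cycle. *)
Lemma acyclic_path_uniq (V : eqType) (G : graph V) (x : V) (p q : seq V) :
  simple_graph G -> acyclic_graph G ->
  path (gedge G) x p -> uniq (x :: p) -> path (gedge G) x q -> uniq (x :: q) ->
  last x p = last x q -> p = q.
Proof.
move=> [sym irr _] acy.
elim: p x q => [|a p IH] x [|b q] //=.
- move=> _ _ _ /andP[xq _] xl; move: xq.
  by rewrite xl mem_last.
- move=> _ /andP[xp _] _ _ xl; move: xp.
  by rewrite -xl mem_last.
move=> /andP[xa pp] /andP[xp up] /andP[xb pq] /andP[xq uq] pq_last.
have [ab|ab] := eqVneq a b.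
  by rewrite -ab in pq uq pq_last *; rewrite (IH a q).
exfalso.
(* [v] is the first vertex of the first path that lies on the second one; the
   initial segments [p1] and [q1] up to [v] meet only in [x] and [v]. *)
pose v := nth x (a :: p) (find (mem (b :: q)) (a :: p)).
have hasv : has (mem (b :: q)) (a :: p).
  by apply/hasP; exists (last a p); rewrite ?mem_last// pq_last; exact: mem_last.
have vq : v \in b :: q by exact: (nth_find x hasv).
have vp : v \in a :: p by rewrite mem_nth// -has_find.
have cap1 w : w \in take (find (mem (b :: q)) (a :: p)) (a :: p) -> w \notin b :: q.
  move=> wt; apply/negP => wq.
  have := has_take_leq (mem (b :: q)) (find_size (mem (b :: q)) (a :: p)).
  rewrite ltnn => /hasP; apply; by exists w.
move: cap1; set k := find _ _ => cap1.
have ks : (k < size (a :: p))%N by rewrite -has_find.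
set p1 := take k (a :: p); set q1 := take (index v (b :: q)) (b :: q).
have is_ : (index v (b :: q) < size (b :: q))%N by rewrite index_mem.
have pth1 : path (gedge G) x (rcons p1 v).
  have : path (gedge G) x (a :: p) by rewrite /= xa pp.
  rewrite -(cat_take_drop k.+1 (a :: p)) cat_path (take_nth x ks) => /andP[+ _].
  by [].
have pth2 : path (gedge G) x (rcons q1 v).
  have : path (gedge G) x (b :: q) by rewrite /= xb pq.
  rewrite -(cat_take_drop (index v (b :: q)).+1 (b :: q)) cat_path (take_nth x is_).
  by rewrite nth_index// => /andP[].
have uq1 : uniq (rcons q1 v).
  have : uniq (b :: q) by [].
  rewrite -(cat_take_drop (index v (b :: q)).+1 (b :: q)) (take_nth x is_).
  by rewrite nth_index// cat_uniq => /andP[].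
have up1 : uniq (rcons p1 v).
  have : uniq (a :: p) by [].
  by rewrite -(cat_take_drop k.+1 (a :: p)) (take_nth x ks) cat_uniq => /andP[].
have q1sub w : w \in q1 -> w \in b :: q by exact: mem_take.
have p1sub w : w \in p1 -> w \in a :: p by exact: mem_take.
have cyc : ucycle (gedge G) (x :: rcons p1 v ++ rev q1).
  apply/andP; split.
    rewrite /= rcons_cat cat_path pth1 last_rcons /=.
    have : path (gedge G) (last x (rcons q1 v)) (rev (belast x (rcons q1 v))).
      by rewrite rev_path; apply: sub_path pth2 => y z; rewrite sym.
    by rewrite last_rcons belast_rcons rev_cons.
  rewrite cons_uniq cat_uniq up1 rev_uniq mem_cat mem_rev mem_rcons inE.
  have -> : (x == v) = false by apply/negP => /eqP xv; rewrite xv vq in xq.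
  rewrite /=; apply/and3P; split.
  - apply/norP; split; first by apply: contra xp; exact: p1sub.
    by apply: contra xq; exact: q1sub.
  - apply/hasPn => w; rewrite mem_rev => wq1; rewrite mem_rcons inE negb_or.
    apply/andP; split.
      by apply/eqP => wv; move: uq1; rewrite rcons_uniq -wv wq1.
    apply/negP => /cap1; by rewrite q1sub.
  - by move: uq1; rewrite rcons_uniq => /andP[].
have := acy _ cyc; rewrite /= size_cat size_rcons size_rev.
case E1 : (size p1) => [|//]; case E2 : (size q1) => [|//] _.
have k0 : k = 0%N by move: E1; rewrite size_take ks.
have i0 : index v (b :: q) = 0%N by move: E2; rewrite size_take is_.
have va : v = a by rewrite /v -/k k0.
have vb : v = b by rewrite -(nth_index x vq) i0.
by move: ab; rewrite -va -vb eqxx.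
Qed.

Definition simple_path (V : eqType) (G : graph V) (x y : V) (p : seq V) : Prop :=
  [/\ path (gedge G) x p, uniq (x :: p) & last x p = y].

Definition tree_path (V : choiceType) (G : graph V) (x y : V) : seq V :=
  xget [::] [set p | simple_path G x y p].

Definition tree_dist (V : choiceType) (G : graph V) (x y : V) : nat :=
  size (tree_path G x y).

Lemma sum_fset_const (V : choiceType) (R : pzSemiRingType) (A : {fset V}) (c : R) :
  \sum_(x <- A) c = #|` A|%:R * c.
Proof. by rewrite big_const_seq count_predT iter_addr addr0 mulr_natl. Qed.

Section tree.
Variables (V : choiceType) (d : nat) (T : graph V).
Hypothesis hT : regular_tree d T.

Lemma tree_path_unique x y p : simple_path T x y p -> tree_path T x y = p.
Proof.
case: hT => simp _ _ acy _ xyp.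
have [q1 q2 q3] : simple_path T x y (tree_path T x y) by exact: (xgetI _ xyp).
by case: xyp => p1 p2 p3; apply: (acyclic_path_uniq simp acy q1 q2 p1 p2); rewrite q3.
Qed.

Lemma tree_pathP x y : simple_path T x y (tree_path T x y).
Proof.
case: hT => simp vT con acy _.
have [||p [pp pl]] := con x y; rewrite ?vT//.
case/shortenP: pp pl => q qp qu _ ql.
have xyq : simple_path T x y q by [].
by rewrite (tree_path_unique xyq).
Qed.

Lemma tree_dist_simple x y p : simple_path T x y p -> tree_dist T x y = size p.
Proof. by move=> /tree_path_unique; rewrite /tree_dist => ->. Qed.

Lemma tree_distxx x : tree_dist T x x = 0%N.
Proof. by rewrite (@tree_dist_simple x x [::]). Qed.

Lemma tree_dist_eq0 x y : tree_dist T x y = 0%N -> x = y.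
Proof.
by have [_ _] := tree_pathP x y; rewrite /tree_dist; case: (tree_path T x y).
Qed.

Lemma tree_dist_le x p : path (gedge T) x p -> (tree_dist T x (last x p) <= size p)%N.
Proof.
move=> /shortenP[q qp qu qsub].
rewrite (@tree_dist_simple x (last x q) q)//.
by apply: uniq_leq_size qsub; case/andP: qu.
Qed.

Lemma tree_edge_dist1 x z : gedge T x z -> tree_dist T z x = 1%N.
Proof.
case: (hT) => -[sym irr _] _ _ _ _ xz.
rewrite (@tree_dist_simple z x [:: x])//; split => //=; first by rewrite sym xz.
by rewrite inE andbT; apply: contraTN xz => /eqP ->; rewrite irr.
Qed.

(** The neighbour [z0] is the next vertex on the path to [y].  Prepending any
    other neighbour to that path keeps it simple, as otherwise this neighbour
    would be reached from [x] by a second simple path. *)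
Lemma tree_dist_neighbors x y : x <> y ->
  exists z0, [/\ gedge T x z0, tree_dist T x y = (tree_dist T z0 y).+1 &
    forall z, gedge T x z -> z <> z0 -> tree_dist T z y = (tree_dist T x y).+1].
Proof.
case: (hT) => -[sym irr simp] vT con acy _ xy.
have := tree_pathP x y; case E : (tree_path T x y) => [|z0 p].
  by case=> _ _ /= xy'; exfalso; exact: xy.
case=> /= /andP[xz0 pp] /andP[xp up] pl.
have dx : tree_dist T x y = (size p).+1 by rewrite /tree_dist E.
exists z0; split => //; first by rewrite dx (@tree_dist_simple z0 y p).
move=> z xz zz0; rewrite dx (@tree_dist_simple z y (x :: z0 :: p))//.
have zx : z != x by apply: contraTN xz => /eqP ->; rewrite irr.
split => //; first by rewrite /= sym xz xz0.
rewrite cons_uniq; apply/andP; split; last by rewrite /= xp.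
rewrite inE (negbTE zx) /=; apply/negP => zp.
have xzz : simple_path T x z [:: z].
  by split => //=; rewrite ?xz// inE eq_sym zx.
have : simple_path T x z (take (index z (z0 :: p)).+1 (z0 :: p)).
  have iz : (index z (z0 :: p) < size (z0 :: p))%N by rewrite index_mem.
  split.
  - by apply: take_path; rewrite /= xz0 pp.
  - have : uniq (x :: z0 :: p) by rewrite cons_uniq xp.
    by move=> /(take_uniq (index z (z0 :: p)).+2).
  - by rewrite (take_nth x iz) last_rcons nth_index.
move=> /tree_path_unique; rewrite (tree_path_unique xzz) /= => -[zz _].
exact: zz0.
Qed.

Lemma tree_dist_parent o y k : tree_dist T o y = k.+1 ->
  exists2 x, tree_dist T o x = k & gedge T x y.
Proof.
have := tree_pathP o y; rewrite /tree_dist.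
case/lastP: (tree_path T o y) => [//|p z] [].
rewrite rcons_path last_rcons size_rcons => /andP[pp pz] up zy [pk].
exists (last o p); last by rewrite -zy.
rewrite -pk; apply: (tree_dist_simple (p := p)); split => //.
by move: up; rewrite -rcons_cons rcons_uniq => /andP[].
Qed.

Lemma finite_neighbors x : finite_set (neighbors T x).
Proof. by case: hT => _ _ _ _ h; apply/finite_setP; exists d. Qed.

Lemma card_neighbors x : #|` fset_set (neighbors T x)| = d.
Proof. by case: hT => _ _ _ _ h; exact: card_fset_set. Qed.

Lemma finite_tree_ball o n : finite_set [set y | (tree_dist T o y <= n)%N].
Proof.
elim: n => [|n IH].
  apply: (@sub_finite_set _ _ [set o]) => // y /=.
  by rewrite leqn0 => /eqP/tree_dist_eq0 ->.
apply: (@sub_finite_set _ _ ([set y | (tree_dist T o y <= n)%N] `|`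
   \bigcup_(x in [set y | (tree_dist T o y <= n)%N]) neighbors T x)).
  move=> y /=; rewrite leq_eqVlt => /orP[/eqP|]; last by left.
  by move=> /tree_dist_parent[x xn xy]; right; exists x => //=; rewrite xn.
rewrite finite_setU; split => //; apply: bigcup_finite => // x _.
exact: finite_neighbors.
Qed.

(** The step of the walk acts on functions of the distance through the radial
    recursion. *)
Lemma sum_neighbors (R : realType) (f : nat -> R) x y :
  \sum_(z <- fset_set (neighbors T x)) f (tree_dist T z y) =
  d%:R * radial_mean (d%:R - 1) f (tree_dist T x y).
Proof.
have fin := finite_neighbors x.
have [<-|/eqP xy] := eqVneq x y.
  rewrite tree_distxx /= -(card_neighbors x) -sum_fset_const.
  rewrite big_seq [RHS]big_seq; apply: eq_bigr => z.
  by rewrite in_fset_set// inE /= => /tree_edge_dist1 ->.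
have [z0 [xz0 dx dz]] := tree_dist_neighbors xy.
have d0 : (0 < d)%N.
  rewrite -(card_neighbors x) cardfs_gt0; apply/fset0Pn; exists z0.
  by rewrite in_fset_set// inE.
have d1 : d%:R != 0 :> R by rewrite pnatr_eq0 -lt0n.
rewrite dx /= subrK mulrCA mulfV// mulr1.
rewrite (big_fsetD1 z0) /=; last by rewrite in_fset_set// inE.
congr (_ + _); rewrite big_seq (eq_bigr (fun _ => f (tree_dist T z0 y).+2)); last first.
  move=> z; rewrite in_fsetD1 in_fset_set// => /andP[/eqP zz0 /set_mem xz].
  by rewrite (dz _ xz zz0) dx.
rewrite -big_seq sum_fset_const; congr (_ * _).
move: (cardfsD1 z0 (fset_set (neighbors T x))).
rewrite card_neighbors in_fset_set// mem_set//= => dE.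
by rewrite dE natrD [X in X - 1]addrC addrK.
Qed.

End tree.

(** * Spheres of a percolation cluster *)

Section cluster.
Variables (V : choiceType) (d : nat) (T : graph V) (S : rel V) (o : V).
Hypothesis hT : regular_tree d T.
Hypothesis ST : subrel S (gedge T).

Let C := component S o.

Lemma component_root : C o. Proof. by exists [::]. Qed.

(** A component of a subgraph of a tree is geodesically convex: a path in it
    shortens to a simple path, which is the only one in the tree. *)
Lemma component_tree_path y : C y -> path S o (tree_path T o y).
Proof.
move=> [p [op <-]]; case/shortenP: op => q oq uq _.
rewrite (tree_path_unique hT (p := q))//.
by split=> //; apply: sub_path oq.
Qed.

Lemma component_step x y : C x -> S x y -> C y.
Proof.
move=> [p [op px]] xy; exists (rcons p y).
by rewrite rcons_path op px last_rcons.
Qed.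

Lemma component_path x p : C x -> path S x p ->
  path (gedge (perc_cluster S o)) x p.
Proof.
elim: p x => [//|y p IH] x Cx /= /andP[xy yp].
have Cy := component_step Cx xy.
by rewrite xy !asboolT//= IH.
Qed.

Lemma gball_cluster n :
  gball (perc_cluster S o) o n = C `&` [set y | (tree_dist T o y <= n)%N].
Proof.
apply/seteqP; split=> [y [p [op py pn]]|y [Cy yn]].
  have So : path S o p by apply: sub_path op => u v /and3P[].
  split; first by exists p.
  rewrite /= -py; apply: leq_trans pn; apply: (tree_dist_le hT).
  exact: sub_path So.
exists (tree_path T o y); split => //.
- by apply: component_path (component_tree_path Cy); exact: component_root.
- by case: (tree_pathP hT o y).
Qed.

Lemma finite_cluster_sphere k : finite_set (C `&` [set y | tree_dist T o y = k]).
Proof.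
apply: sub_finite_set (finite_tree_ball hT o k) => y [_ /= ->] //.
Qed.

Lemma finite_cluster_ball k :
  finite_set (C `&` [set y | (tree_dist T o y <= k)%N]).
Proof. exact: sub_finite_set (@subIsetr _ _ _) (finite_tree_ball hT o k). Qed.

Definition cluster_sphere (k : nat) : nat :=
  #|` fset_set (C `&` [set y | tree_dist T o y = k])|.

Lemma cluster_sphere0 : cluster_sphere 0 = 1%N.
Proof.
rewrite /cluster_sphere (_ : _ `&` _ = [set o]) ?fset_set1 ?cardfs1//.
apply/seteqP; split=> [y [_ /= /(tree_dist_eq0 hT) ->]//|y /= ->].
by split; [exact: component_root|exact: tree_distxx hT _].
Qed.

Lemma sum_cluster_ball (R : pzSemiRingType) (f : nat -> R) n :
  \sum_(y <- fset_set (C `&` [set y | (tree_dist T o y <= n)%N])) f (tree_dist T o y)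
  = \sum_(k < n.+1) (cluster_sphere k)%:R * f k.
Proof.
have sph k : \sum_(y <- fset_set (C `&` [set y | tree_dist T o y = k]))
    f (tree_dist T o y) = (cluster_sphere k)%:R * f k.
  rewrite -sum_fset_const big_seq [RHS]big_seq; apply: eq_bigr => y.
  by rewrite in_fset_set ?inE; [move=> [_ /= ->]|exact: finite_cluster_sphere].
elim: n => [|n IH].
  rewrite big_ord1 /= -sph; congr (\sum_(y <- fset_set _) _).
  by apply/seteqP; split=> y [? /=]; rewrite leqn0 => /eqP.
rewrite big_ord_recr /= -IH -sph addrC.
rewrite (big_fsetID _ (fun y => tree_dist T o y == n.+1)) /=.
have finb := finite_cluster_ball; have fins := finite_cluster_sphere.
congr (_ + _); apply: eq_fbigl => y; rewrite !inE /= !in_fset_set//.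
  apply/andP/idP => [[/set_mem[Cy _] /eqP yn]|/set_mem[Cy /= yn]].
    exact/mem_set.
  by split; [apply/mem_set; split => //=; rewrite yn|rewrite yn].
apply/andP/idP => [[/set_mem[Cy /= yn] ynn]|/set_mem[Cy /= yn]].
  by apply/mem_set; split => //=; rewrite -ltnS ltn_neqAle ynn.
split; first by apply/mem_set; split => //=; exact: leqW.
by rewrite neq_ltn ltnS yn.
Qed.

Lemma card_cluster_ball n :
  #|` fset_set (gball (perc_cluster S o) o n)| = (\sum_(k < n.+1) cluster_sphere k)%N.
Proof.
rewrite gball_cluster; have := @sum_cluster_ball nat (fun=> 1%N) n.
rewrite sum_fset_const mulr1 natn => ->.
by apply: eq_bigr => i _; rewrite mulr1 natn.
Qed.

(** Every vertex of the sphere k + 1 is a neighbour of its predecessor on the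
    path from the root, which is in the cluster by convexity. *)
Lemma cluster_sphereS k : (cluster_sphere k.+1 <= d * cluster_sphere k)%N.
Proof.
set A := fset_set (C `&` [set y | tree_dist T o y = k]).
pose B := (\big[fsetU/fset0]_(x <- A) fset_set (neighbors T x))%fset.
have cB : (#|` B| <= \sum_(x <- A) d)%N.
  rewrite /B; elim/big_ind2 : _ => //.
  - move=> X n Y p Xn Yp; rewrite cardfsU; lia.
  - by move=> x _; rewrite (card_neighbors hT).
move: cB; rewrite big_const_seq count_predT iter_addn addn0 => cB.
apply: leq_trans cB; apply: fsubset_leq_card; apply/fsubsetP => y.
rewrite in_fset_set; last exact: finite_cluster_sphere.
rewrite inE => -[Cy /= yk].
have [_ uy ly] := tree_pathP hT o y; have Sy := component_tree_path Cy.
move: yk uy ly Sy; rewrite /tree_dist.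
case/lastP: (tree_path T o y) => [//|p z].
rewrite size_rcons last_rcons => -[pk] + zy; rewrite {}zy.
rewrite -rcons_cons rcons_uniq rcons_path => up /andP[Sp Sxy].
have xA : last o p \in A.
  rewrite in_fset_set; last exact: finite_cluster_sphere.
  rewrite inE; split; first by exists p.
  rewrite /= -pk; apply: (tree_dist_simple hT); split => //; first exact: sub_path Sp.
  by case/andP: up.
rewrite /B (big_fsetD1 _ xA) /= in_fsetU in_fset_set; last exact: (finite_neighbors hT).
by rewrite mem_set//=; exact: ST.
Qed.

End cluster.

(** * The law of a walk on the regular tree *)

Lemma negligible_countable_bigcup d (W : measurableType d) (R : realType)
    (mu : {measure set W -> \bar R}) (V : countType) (F : V -> set W) :
  (forall z, mu.-negligible (F z)) -> mu.-negligible (\bigcup_z F z).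
Proof.
move=> F0; pose G n := if choice.unpickle n is Some z then F z else set0.
have : mu.-negligible (\bigcup_n G n).
  apply: negligible_bigcup => n; rewrite /G; case: choice.unpickle => [z|] //.
  exact: negligible_set0.
by apply: negligibleS => w [z _ Fz]; exists (choice.pickle z); rewrite // /G choice.pickleK.
Qed.

(** Total probability over the values of [Z], when only finitely many of them
    contribute. *)
Lemma measure_fiber_sum d (W : measurableType d) (R : realType)
    (mu : {measure set W -> \bar R}) (V : countType) (Z : W -> V)
    (F : {fset V}) (A : set W) :
  (forall z, measurable [set w | Z w = z]) -> measurable A ->
  (forall z, z \notin F -> mu (A `&` [set w | Z w = z]) = 0%E) ->
  mu A = (\sum_(z <- F) mu (A `&` [set w | Z w = z]))%E.
Proof.
move=> mZ mA A0; pose G z := A `&` [set w | Z w = z].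
have mG z : measurable (G z) by exact: measurableI.
have tG D : trivIset D G.
  apply/trivIsetP => i j _ _ /eqP ij; apply/seteqP; split=> // w.
  by move=> [[_ /= Zi] [_ /= Zj]]; apply: ij; rewrite -Zi.
rewrite -measure_fbigsetU//; last by move=> z _; exact: mG.
rewrite -bigcup_fset; set B := \bigcup_(z in _) _.
pose N := \bigcup_z (if z \in F then set0 else G z).
have mN : measurable N.
  apply: countable_bigcupT_measurable; first exact: countableP.
  by move=> z; case: ifP.
have mB : measurable B by apply: fin_bigcup_measurable => [|z _]; [exact: finite_fset|exact: mG].
have -> : A = B `|` N.
  apply/seteqP; split=> [w Aw|w [[z _ [] //]|[z _]]]; last by case: ifP => // _ [].
  have [wF|wF] := boolP (Z w \in F); first by left; exists (Z w).
  by right; exists (Z w) => //; rewrite (negbTE wF).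
rewrite measureU0//; apply: measure_negligible => //.
apply: negligible_countable_bigcup => z; case: ifPn => [_|zF]; first exact: negligible_set0.
by apply/negligibleP => //; exact: A0.
Qed.

(** Common form of the simple kernel ([a = 0]) and the lazy one ([a = 1/2]). *)
Definition hold_step (R : realType) (V : eqType) (a : R) (d : nat) (T : graph V)
    (x y : V) : R :=
  if x == y then a else if gedge T x y then (1 - a) / d%:R else 0.

Lemma simple_stepE (R : realType) (V : eqType) d (T : graph V) :
  simple_graph T -> simple_step (R := R) d T = hold_step 0 d T.
Proof.
move=> [_ irr _]; apply/funext => x; apply/funext => y.
rewrite /simple_step /hold_step; case: eqVneq => [->|_]; first by rewrite irr.
by rewrite subr0 mul1r.
Qed.

Lemma lazy_stepE (R : realType) (V : eqType) d (T : graph V) :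
  lazy_step (R := R) d T = hold_step 2^-1 d T.
Proof.
apply/funext => x; apply/funext => y.
rewrite /lazy_step /hold_step; case: eqP => // _; case: ifP => // _.
by rewrite invfM; congr (_ * _); lra.
Qed.

Section markov.
Context {R : realType} {dW : measure_display} {W : measurableType dW}.
Variables (Q : probability W R) (V : countType) (d : nat) (T : graph V) (o : V).
Variables (a : R) (X : nat -> W -> V).
Hypotheses (hT : regular_tree d T) (d_gt0 : (0 < d)%N).
Hypothesis hX : markov_chain Q (hold_step a d T) o X.

Let mX n x : measurable [set w | X n w = x]. Proof. by case: hX. Qed.

Definition cylinder (n : nat) (x : nat -> V) : set W :=
  [set w | forall i, (i <= n)%N -> X i w = x i].

Lemma cylinderS n x : cylinder n.+1 x = cylinder n x `&` [set w | X n.+1 w = x n.+1].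
Proof.
apply/seteqP; split=> w.
  by move=> wx; split => [i ij|]; apply: wx => //; exact: leqW.
by move=> [wx wn] i; rewrite leq_eqVlt => /orP[/eqP ->//|]; exact: wx.
Qed.

Lemma measurable_cylinder n x : measurable (cylinder n x).
Proof.
elim: n => [|n IH]; last by rewrite cylinderS; exact: measurableI.
rewrite (_ : cylinder 0 x = [set w | X 0%N w = x 0%N])//.
apply/seteqP; split=> w; first by apply.
by move=> wx i; rewrite leqn0 => /eqP ->.
Qed.

Let m : R := d%:R - 1.

Lemma step_radial_law (n : nat) (x y : V) :
  \sum_(z <- (x |` fset_set (neighbors T x))%fset)
     hold_step a d T x z * radial_law m a n (tree_dist T z y) =
  radial_law m a n.+1 (tree_dist T x y).
Proof.
have irr : irreflexive (gedge T) by case: hT => -[].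
have fin := finite_neighbors hT x.
have d0 : d%:R != 0 :> R by rewrite pnatr_eq0 -lt0n.
have xN : x \notin fset_set (neighbors T x).
  by rewrite in_fset_set//; apply/negP => /set_mem; rewrite /neighbors /= irr.
rewrite big_fsetU1//= {1}/hold_step eqxx -/(radial_law m a n) /radial_op.
congr (_ + _).
rewrite big_seq (eq_bigr (fun z =>
  (1 - a) / d%:R * radial_law m a n (tree_dist T z y))); last first.
  move=> z; rewrite in_fset_set// => /set_mem; rewrite /neighbors /= => xz.
  rewrite /hold_step xz; case: eqP => // xz'.
  by rewrite -xz' irr in xz.
by rewrite -big_seq -mulr_sumr (sum_neighbors hT) -mulrA mulKf.
Qed.

(** The Markov property, by induction on the number [j] of further steps: the
    position after the first of them is a neighbour of [x n] or [x n] itself. *)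
Lemma cylinder_law (j n : nat) (x : nat -> V) (y : V) :
  Q (cylinder n x `&` [set w | X (n + j)%N w = y]) =
  (Q (cylinder n x) * (radial_law m a j (tree_dist T (x n) y))%:E)%E.
Proof.
elim: j n x => [|j IH] n x.
  rewrite addn0 /=; have [/(tree_dist_eq0 hT) xy|xy] := eqVneq (tree_dist T (x n) y) 0%N.
    rewrite mule1; congr (Q _); apply/seteqP; split=> w; first by case.
    by move=> wx; split=> //=; rewrite -xy; exact: wx.
  rewrite mule0 (_ : _ `&` _ = set0) ?measure0//.
  apply/seteqP; split=> // w [/(_ n (leqnn n)) xn /= wy].
  by move: xy; rewrite -xn wy (tree_distxx hT) eqxx.
(* The trajectory [x] up to time [n], continued by [z]. *)
pose ext z i := if i == n.+1 then z else x i.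
have extn z : cylinder n (ext z) = cylinder n x.
  apply/seteqP; split=> w wx i ni; have := wx i ni; rewrite /ext.
    by rewrite ltn_eqF.
  by rewrite ltn_eqF.
have part z : Q (cylinder n x `&` [set w | X (n + j.+1)%N w = y] `&`
     [set w | X n.+1 w = z]) =
   (Q (cylinder n x) * (hold_step a d T (x n) z *
      radial_law m a j (tree_dist T z y))%:E)%E.
  have -> : cylinder n x `&` [set w | X (n + j.+1)%N w = y] `&` [set w | X n.+1 w = z] =
     cylinder n.+1 (ext z) `&` [set w | X (n.+1 + j)%N w = y].
    by rewrite cylinderS extn [ext z n.+1]/ext eqxx addSnnS setIAC.
  rewrite IH [ext z n.+1]/ext eqxx EFinM muleA; congr (_ * _)%E.
  have [_ law] := hX; rewrite /cylinder !law big_ord_recr /= mulrA EFinM.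
  rewrite [ext z n.+1]/ext eqxx [ext z n]/ext [ext z 0]/ext /= ltn_eqF//.
  congr (_ * _)%E; congr (_ * _)%:E.
  by apply: eq_bigr => i _; rewrite /ext !ltn_eqF// ?ltnS// ltnW.
rewrite (measure_fiber_sum (Z := X n.+1) (F := (x n |` fset_set (neighbors T (x n)))%fset)).
- rewrite (eq_bigr _ (fun z _ => part z)) -step_radial_law.
  have -> : Q (cylinder n x) = (fine (Q (cylinder n x)))%:E.
    by rewrite fineK// fin_num_measure//; exact: measurable_cylinder.
  by rewrite -EFinM mulr_sumr -sumEFin; apply: eq_bigr => z _; rewrite EFinM.
- exact: mX.
- by apply: measurableI; [exact: measurable_cylinder|exact: mX].
move=> z zF; apply: (etrans (part z)); rewrite (_ : hold_step a d T (x n) z = 0) ?mul0r ?mule0//.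
move: zF; rewrite in_fset1U negb_or => /andP[/negbTE xz].
rewrite in_fset_set; last exact: (finite_neighbors hT).
move=> zN; rewrite /hold_step eq_sym xz ifF//.
by apply: contraNF zN => zN; exact: mem_set.
Qed.

Lemma markov_law n y :
  Q [set w | X n w = y] = (radial_law m a n (tree_dist T o y))%:E.
Proof.
have [_ law] := hX.
have start z : Q [set w | X 0%N w = z] = ((z == o)%:R)%:E.
  have := law 0%N (fun=> z); rewrite big_ord0 mulr1 => <-; congr (Q _).
  apply/seteqP; split=> w /=; first by move=> wz i; rewrite leqn0 => /eqP ->.
  by apply.
rewrite (measure_fiber_sum (Z := X 0%N) (F := [fset o]%fset)); [|exact: mX|exact: mX|].
  rewrite big_seq_fset1 setIC.
  have := cylinder_law n 0 (fun=> o) y; rewrite add0n.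
  have -> : cylinder 0 (fun=> o) = [set w | X 0%N w = o].
    apply/seteqP; split=> w /=; last by move=> wz i; rewrite leqn0 => /eqP ->.
    by apply.
  by rewrite start eqxx mul1e.
move=> z; rewrite inE => zo; apply/eqP; rewrite -measure_le0.
apply: (@le_trans _ _ (Q [set w | X 0%N w = z])); last by rewrite start (negbTE zo).
by apply: le_measure; rewrite ?inE; [apply: measurableI; exact: mX|exact: mX|exact: subIsetr].
Qed.

Lemma sampling_cluster (S : rel V) n :
  Q [set w | gvert (perc_cluster S o) (X n w)] =
  (sampled_mass m a (cluster_sphere T S o) n)%:E.
Proof.
have mC (D : set V) : measurable [set w | D (X n w)].
  have -> : [set w | D (X n w)] = \bigcup_z (if z \in D then [set w | X n w = z] else set0).
    apply/seteqP; split=> [w Dw|w [z _]].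
      by exists (X n w) => //; rewrite mem_set.
    by case: ifP => // /set_mem Dz /= ->.
  apply: countable_bigcupT_measurable; first exact: countableP.
  by move=> z; case: ifP => // _; exact: mX.
pose C := component S o.
have -> : [set w | gvert (perc_cluster S o) (X n w)] = [set w | C (X n w)].
  by apply/seteqP; split=> [w []|w].
rewrite (measure_fiber_sum (Z := X n)
  (F := fset_set (C `&` [set y | (tree_dist T o y <= n)%N]))); [|exact: mX|exact: mC|].
- rewrite /sampled_mass -(sum_cluster_ball S o hT) -sumEFin.
  rewrite big_seq [RHS]big_seq; apply: eq_bigr => y.
  rewrite in_fset_set; last exact: (finite_cluster_ball S o hT).
  move=> /set_mem[Cy _]; rewrite -markov_law; congr (Q _).
  by apply/seteqP; split=> [w []//|w /= wy]; split => //=; rewrite wy.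
move=> z; rewrite in_fset_set; last exact: (finite_cluster_ball S o hT).
move=> zn; have [Cz|Cz] := pselect (C z); last first.
  rewrite (_ : _ `&` _ = set0) ?measure0//; apply/seteqP; split=> // w [/= Cw wz].
  by apply: Cz; rewrite -wz.
apply/eqP; rewrite -measure_le0.
apply: (@le_trans _ _ (Q [set w | X n w = z])).
  apply: le_measure; rewrite ?inE; [|exact: mX|exact: subIsetr].
  by apply: measurableI; [exact: mC|exact: mX].
rewrite markov_law radial_law_supp//.
by rewrite ltnNge; apply: contra zn => zn; apply/mem_set.
Qed.

End markov.

(** * Isomorphisms of rooted graphs *)

Local Open Scope card_scope.

Section graph_iso_theory.

Lemma graph_iso_comp U V W (G : graph U) (H : graph V) (K : graph W) f g :
  graph_iso G H f -> graph_iso H K g -> graph_iso G K (g \o f).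
Proof.
move=> [[f1 f2 f3] fe] [[g1 g2 g3] ge]; split; last first.
  by move=> x y Gx Gy; rewrite /= ge ?fe//; exact: f1.
split.
- by move=> x Gx; apply: g1; exact: f1.
- move=> x y xG yG /= e; apply: (f2 _ _ xG yG).
  by apply: (g2 _ _ _ _ e); apply/mem_set; apply: f1; exact: set_mem.
- move=> z /g3[y /f3[x Gx <-] <-]; by exists x.
Qed.

Lemma graph_iso_inv V W (G : graph V) (H : graph W) f (x0 : V) :
  graph_iso G H f -> gvert G x0 ->
  exists g, graph_iso H G g /\ forall x, gvert G x -> g (f x) = x.
Proof.
move=> [[f1 f2 f3] fe] Gx0.
have [g gP] : exists g : W -> V, forall y, gvert H y -> gvert G (g y) /\ f (g y) = y.
  have /choice[g gP] : forall y, exists x, gvert H y -> gvert G x /\ f x = y.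
    move=> y; have [/f3[x Gx xy]|Hy] := pselect (gvert H y); first by exists x.
    by exists x0.
  by exists g.
have gK x : gvert G x -> g (f x) = x.
  move=> Gx; have [? e] := gP _ (f1 _ Gx).
  by apply: (f2 _ _ _ _ e); exact: mem_set.
exists g; split; last exact: gK.
split; last first.
  by move=> x y /gP[Gx ex] /gP[Gy ey]; rewrite -fe// ex ey.
split.
- by move=> y /gP[].
- move=> x y /set_mem/gP[_ ex] /set_mem/gP[_ ey] e; by rewrite -ex -ey e.
- by move=> x Gx; exists (f x); [exact: f1|exact: gK].
Qed.

Lemma gball_vert V (G : graph V) x n : simple_graph G -> gvert G x ->
  gball G x n `<=` gvert G.
Proof.
move=> [sym _ Gv] Gx y [p [pp <- _]].
elim: p x Gx pp => [//|z p IH] x Gx /= /andP[xz zp].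
by apply: IH zp; apply: (Gv z x); rewrite sym.
Qed.

Lemma graph_iso_path V W (G : graph V) (H : graph W) f x p :
  simple_graph G -> graph_iso G H f -> gvert G x -> path (gedge G) x p ->
  path (gedge H) (f x) (map f p).
Proof.
move=> [sym _ Gv] [_ fe].
elim: p x => [//|z p IH] x Gx /= /andP[xz zp].
have Gz : gvert G z by apply: (Gv z x); rewrite sym.
by rewrite fe// xz IH.
Qed.

Lemma graph_iso_gball V W (G : graph V) (H : graph W) f x n :
  simple_graph G -> simple_graph H -> graph_iso G H f -> gvert G x ->
  gball H (f x) n = f @` gball G x n.
Proof.
move=> sG sH iso Gx; have [g [giso gK]] := graph_iso_inv iso Gx.
have [[f1 f2 f3] _] := iso.
apply/seteqP; split => [y [p [Hp py pn]]|y [z [p [Gp pz pn]] <-]]; last first.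
  exists (map f p); split; first exact: graph_iso_path Gp.
    by rewrite last_map pz.
  by rewrite size_map.
have Hy : gvert H y by apply: (gball_vert sH (f1 _ Gx) (n := n)); exists p.
have [z Gz zy] := f3 _ Hy; exists z => //; exists (map g p); split.
- by rewrite -[x]gK//; apply: (graph_iso_path sH giso (f1 _ Gx)).
- by rewrite -[x]gK// last_map py -zy gK.
- by rewrite size_map.
Qed.

Lemma graph_iso_induced_ball V W (G : graph V) (H : graph W) f x n :
  simple_graph G -> simple_graph H -> graph_iso G H f -> gvert G x ->
  graph_iso (Defs.induced G (gball G x n)) (Defs.induced H (gball H (f x) n)) f.
Proof.
move=> sG sH iso Gx; have bE := graph_iso_gball n sG sH iso Gx.
have [[f1 f2 f3] fe] := iso.
have inb z : gvert G z -> gball H (f x) n (f z) -> gball G x n z.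
  rewrite bE => Gz [z' bz' e].
  suff <- : z' = z by [].
  by apply: f2 e; apply/mem_set => //; exact: (gball_vert sG Gx bz').
split.
  split.
  - by move=> z [Gz bz]; split; [exact: f1|rewrite bE; exists z].
  - move=> z t /set_mem[Gz _] /set_mem[Gt _]; apply: f2; exact: mem_set.
  - move=> y [Hy]; rewrite bE => -[z bz zy]; exists z => //; split => //.
    exact: (gball_vert sG Gx bz).
move=> z t [Gz bz] [Gt bt] /=; rewrite fe//.
by rewrite !asboolT// bE; [exists t|exists z].
Qed.

Lemma growth_graph_iso (R : realType) (V W : choiceType) (G : graph V) (H : graph W) f x :
  simple_graph G -> simple_graph H -> graph_iso G H f -> gvert G x ->
  (forall n, finite_set (gball H (f x) n)) ->
  growth_seq R G x = growth_seq R H (f x).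
Proof.
move=> sG sH iso Gx fin; apply/funext => n; rewrite /growth_seq; congr (_%:R `^ _).
have bE := graph_iso_gball n sG sH iso Gx.
have cE : gball G x n #= gball H (f x) n.
  rewrite bE card_eq_sym; apply: inj_card_eq => z t /set_mem zb /set_mem tb.
  have [[_ f2 _] _] := iso.
  by apply: f2; apply/mem_set; apply: gball_vert sG Gx _ _; eassumption.
apply/fcard_eq => //; apply/finite_setP; move/finite_setP: (fin n) => [k kE].
by exists k; exact: card_eq_trans cE kE.
Qed.

End graph_iso_theory.

Section representative.
Variables (V : countType) (d : nat) (H : graph V) (o : V).
Hypotheses (sH : simple_graph H) (cH : connected_graph H) (dH : degree_le d H).
Hypothesis Ho : gvert H o.

Let pk := @choice.pickle V.
Let pk_inj : injective pk. Proof. exact: (pcan_inj choice.pickleK). Qed.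

Let G : graph nat := Graph (pk @` gvert H)
  (fun i j => `[< exists x y, [/\ pk x = i, pk y = j & gedge H x y] >]).

Let GE x y : gedge G (pk x) (pk y) = gedge H x y.
Proof.
apply/asboolP/idP => [[x' [y' [/pk_inj -> /pk_inj ->]]]//|xy].
by exists x, y.
Qed.

Let G_simple : simple_graph G.
Proof.
case: sH => sym irr Hv; split.
- move=> i j; apply/asboolP/asboolP => -[x [y [xi yj xy]]];
  by exists y, x; rewrite sym.
- move=> i; apply/asboolP => -[x [y [<- /pk_inj ->]]]; by rewrite irr.
- by move=> i j /asboolP[x [y [<- _ /Hv xH]]]; exists x.
Qed.

Let G_connected : connected_graph G.
Proof.
move=> _ _ [x Hx <-] [y Hy <-]; have [p [xp <-]] := cH Hx Hy.
exists (map pk p); rewrite last_map; split => //.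
elim: p x {Hx} xp => [//|z p IH] x /= /andP[xz zp].
by apply/andP; split; [exact: (etrans (GE x z))|exact: IH].
Qed.

Let G_degree : degree_le d G.
Proof.
move=> _ [x Hx <-]; apply: card_le_trans (dH Hx).
apply: card_le_trans (card_image_le pk _); apply: subset_card_le.
by move=> _ /asboolP[x' [y [/pk_inj <- <- xy]]]; exists y.
Qed.

Let Gc : cgraph d := CGraph G_simple G_connected G_degree.

Let Go : gvert Gc (pk o). Proof. by exists o. Qed.

(** The vertices are renamed by their codes in [nat]. *)
Lemma rgraph_representative : exists (K : Defs.rgraph d) (f : nat -> V),
  graph_iso K H f /\ f (val (rg_root K)) = o.
Proof.
exists (@RGraph d Gc (SigSub (mem_set Go))), (fun n => odflt o (choice.unpickle n)).
have fK x : odflt o (choice.unpickle (pk x)) = x by rewrite /pk choice.pickleK.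
split; last exact: fK.
split.
  split.
  - by move=> _ [x Hx <-]; rewrite /= fK.
  - by move=> i j /set_mem[x _ <-] /set_mem[y _ <-]; rewrite !fK => ->.
  - by move=> x Hx; exists (pk x); [exists x|rewrite fK].
by move=> _ _ [x _ <-] [y _ <-]; rewrite !fK; exact: (esym (GE _ _)).
Qed.

End representative.

(** * Measurability of events on the cluster *)

Section cluster_graph.
Variables (V : countType) (d : nat) (T : graph V) (o : V).
Hypothesis hT : regular_tree d T.

Definition tree_subgraph (S : rel V) : Prop := symmetric S /\ subrel S (gedge T).

Lemma cluster_simple S : tree_subgraph S -> simple_graph (perc_cluster S o).
Proof.
case: (hT) => -[_ irr _] _ _ _ _ [sym ST]; split.
- by move=> x y /=; rewrite sym [in RHS]andbCA [X in _ && X]andbC andbCA.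
- move=> x /=; apply/negP => /and3P[/ST]; by rewrite irr.
- by move=> x y /and3P[_ /asboolP Cx _]; split.
Qed.

Lemma cluster_connected S : tree_subgraph S -> connected_graph (perc_cluster S o).
Proof.
move=> [sym ST] x y [_ Cx] [_ Cy].
have [p [op px]] := Cx; have [q [oq qy]] := Cy.
exists (rev (belast o p) ++ q); split; last first.
  rewrite last_cat -[last x _]/(last x (rev (belast o p))).
  suff -> : last x (rev (belast o p)) = o by [].
  case/lastP: p op px {Cx} => [|p z] //=.
  by case: p => [|u p] //=; rewrite ?rev_cons ?last_rcons.
apply: component_path => //; rewrite cat_path -{1}px rev_path.
apply/andP; split; first by apply: sub_path op => u v; rewrite sym.
suff -> : last x (rev (belast o p)) = o by [].
case/lastP: p op px {Cx} => [|p z] //=.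
by case: p => [|u p] //=; rewrite ?rev_cons ?last_rcons.
Qed.

Lemma cluster_degree S : tree_subgraph S -> degree_le d (perc_cluster S o).
Proof.
case: (hT) => _ _ _ _ deg [_ ST] x _.
have : neighbors T x #<= `I_d by move: (deg x) => /card_eqPle[].
by apply: card_le_trans; apply: subset_card_le => y /and3P[/ST].
Qed.

Lemma cluster_representative S : tree_subgraph S ->
  exists (K : Defs.rgraph d) (f : nat -> V),
    graph_iso K (perc_cluster S o) f /\ f (val (rg_root K)) = o.
Proof.
move=> sS; apply: rgraph_representative; last by split => //; exact: component_root.
- exact: cluster_simple.
- exact: cluster_connected.
- exact: cluster_degree.
Qed.

Definition agree_on_ball (r : nat) (S S' : rel V) : Prop := forall x y,
  (tree_dist T o x <= r)%N -> (tree_dist T o y <= r)%N -> S x y = S' x y.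

(** A path of length at most r from the root stays in the ball of radius r, so
    it only uses edges on which the two configurations agree. *)
Lemma agree_path r (S S' : rel V) p : subrel S (gedge T) -> agree_on_ball r S S' ->
  path S o p -> (size p <= r)%N -> path S' o p.
Proof.
move=> ST agr; elim/last_ind: p => [//|p z IH].
rewrite !rcons_path size_rcons => /andP[op pz] pr.
rewrite IH//; last exact: ltnW.
have To : path (gedge T) o (rcons p z).
  by apply: (sub_path ST); rewrite rcons_path op.
rewrite -agr//.
  apply: leq_trans (ltnW pr); apply: (tree_dist_le hT).
  by move: To; rewrite rcons_path => /andP[].
by have := tree_dist_le hT To; rewrite last_rcons size_rcons => /leq_trans; apply.
Qed.

Lemma agree_component r (S S' : rel V) y : subrel S (gedge T) ->
  agree_on_ball r S S' -> (tree_dist T o y <= r)%N ->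
  component S o y -> component S' o y.
Proof.
move=> ST agr yr Cy; exists (tree_path T o y); split.
  by apply: (agree_path ST agr) => //; exact: (component_tree_path hT ST Cy).
by case: (tree_pathP hT o y).
Qed.

(** The r-ball of the cluster is determined by the configuration on the r-ball
    of the tree, because distances in the cluster are distances in the tree. *)
Lemma agree_induced_ball r (S S' : rel V) : subrel S (gedge T) ->
  subrel S' (gedge T) -> agree_on_ball r S S' ->
  Defs.induced (perc_cluster S o) (gball (perc_cluster S o) o r) =
  Defs.induced (perc_cluster S' o) (gball (perc_cluster S' o) o r).
Proof.
move=> ST ST' agr.
have agr' : agree_on_ball r S' S by move=> x y xr yr; rewrite agr.
have bE : gball (perc_cluster S o) o r = gball (perc_cluster S' o) o r.
  rewrite !(gball_cluster o hT)//; apply/seteqP; split=> y [Cy yr]; split => //.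
    by apply: (agree_component _ _ yr Cy).
  by apply: (agree_component _ _ yr Cy).
have inb y : gball (perc_cluster S o) o r y ->
  [/\ (tree_dist T o y <= r)%N, component S o y & component S' o y].
  move=> by_; split.
  - by move: by_; rewrite (gball_cluster o hT)// => -[].
  - by move: by_; rewrite (gball_cluster o hT)// => -[].
  - by move: by_; rewrite bE (gball_cluster o hT)// => -[].
rewrite /Defs.induced; congr Graph.
  rewrite -bE; apply/seteqP; split=> y [_ /[dup] by_ /inb[yr yC yC']]; split => //;
  by split.
apply/funext => x; apply/funext => y; rewrite -bE /=.
have [bx|bx] := pselect (gball (perc_cluster S o) o r x); last first.
  by rewrite [asbool (gball _ _ _ x)]asboolF ?andbF.
have [by_|by_] := pselect (gball (perc_cluster S o) o r y); last first.
  by rewrite [asbool (gball _ _ _ y)]asboolF ?andbF.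
have [xr xC xC'] := inb _ bx; have [yr yC yC'] := inb _ by_.
by rewrite agr// !asboolT.
Qed.

Definition iso_to_cluster (S : rel V) (G : Defs.rgraph d) : Prop :=
  exists f : nat -> V,
    graph_iso G (perc_cluster S o) f /\ f (val (rg_root G)) = o.

Lemma iso_to_cluster_ball r (S : rel V) (G : Defs.rgraph d) : tree_subgraph S ->
  iso_to_cluster S G -> exists f,
    graph_iso (Defs.induced G (gball G (val (rg_root G)) r))
      (Defs.induced (perc_cluster S o) (gball (perc_cluster S o) o r)) f /\
    f (val (rg_root G)) = o.
Proof.
move=> sS [f [iso fo]]; exists f; split => //.
rewrite -[X in gball (perc_cluster S o) X]fo; apply: graph_iso_induced_ball => //.
- exact: cgraph_simple.
- exact: cluster_simple.
- exact: set_valP.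
Qed.

(** With [S = S'] this says that the isomorphism type of a ball does not depend
    on the representative of the cluster. *)
Lemma rg_iso_balls_cluster r (S S' : rel V) (G G' : Defs.rgraph d) :
  tree_subgraph S -> tree_subgraph S' -> agree_on_ball r S S' ->
  iso_to_cluster S G -> iso_to_cluster S' G' -> rg_iso_balls r G G'.
Proof.
move=> sS sS' agr /(iso_to_cluster_ball r sS)[f [isof fo]].
move=> /(iso_to_cluster_ball r sS')[f' [isof' f'o]].
have root' : gvert (Defs.induced G' (gball G' (val (rg_root G')) r)) (val (rg_root G')).
  by split; [exact: set_valP|exists [::]].
have [g [isog gK]] := graph_iso_inv isof' root'.
rewrite (agree_induced_ball sS.2 sS'.2 agr) in isof.
exists (g \o f); split; first exact: graph_iso_comp isof isog.
by rewrite /= fo -f'o gK.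
Qed.

Lemma rg_iso_balls_trans r (G H K : Defs.rgraph d) :
  rg_iso_balls r G H -> rg_iso_balls r H K -> rg_iso_balls r G K.
Proof.
move=> [f [isof fo]] [g [isog go]]; exists (g \o f); split.
  exact: graph_iso_comp isof isog.
by rewrite /= fo.
Qed.

End cluster_graph.

Section measurability.
Context {dO : measure_display} {Omega : measurableType dO}.
Variables (V : countType) (E : Omega -> V -> V -> bool).
Hypothesis mE : measurable_fun setT (E : Omega -> edge_config V).

Lemma measurable_edge x y (b : bool) : measurable [set w | E w x y = b].
Proof.
have mt : measurable [set w | E w x y = true].
  have mxy : measurable ([set S | S x y] : set (edge_config V)).
    by apply: sub_sigma_algebra; exists x, y.
  by have := mE measurableT mxy; rewrite setTI.
case: b => //.
rewrite (_ : [set w | _] = ~` [set w | E w x y = true]); first exact: measurableC.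
by apply/seteqP; split=> w /=; case: (E w x y).
Qed.

(** The event is a countable union of cylinders: the restrictions to the finite
    set [D] of the configurations in it are coded by finite subsets of [D]. *)
Lemma measurable_local_event (D : set (V * V)) (P : (V -> V -> bool) -> Prop) :
  finite_set D ->
  (forall w w', (forall e, D e -> E w e.1 e.2 = E w' e.1 e.2) ->
    P (E w) -> P (E w')) ->
  measurable [set w | P (E w)].
Proof.
move=> finD loc.
pose M (s : {fset V * V}) := \bigcap_(e in D) [set w | E w e.1 e.2 = (e \in s)].
pose N s := if `[< exists2 w, P (E w) & M s w >] then M s else set0.
have -> : [set w | P (E w)] = \bigcup_s N s.
  apply/seteqP; split=> [w Pw|w [s _]]; last first.
    rewrite /N; case: asboolP => // -[w' Pw' Mw'] Mw.
    by apply: loc Pw' => e De; rewrite Mw'// Mw.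
  pose s := fset_set (D `&` [set e | E w e.1 e.2]).
  have Ms : M s w.
    move=> e De /=; rewrite in_fset_set; last exact: finite_setIl.
    by apply/idP/idP => [Ee|/set_mem[]//]; apply/mem_set.
  by exists s => //; rewrite /N asboolT//; exists w.
apply: countable_bigcupT_measurable; first exact: countableP.
move=> s; rewrite /N; case: ifP => // _; apply: fin_bigcap_measurable => // e _.
exact: measurable_edge.
Qed.

End measurability.

Section cluster_law.
Context {R : realType} {dO : measure_display} {Omega : measurableType dO}.
Variables (P : probability Omega R) (V : countType) (d : nat) (T : graph V) (o : V).
Variable E : Omega -> V -> V -> bool.
Hypothesis hT : regular_tree d T.
Hypothesis sE : forall w, tree_subgraph T (E w).
Hypothesis mE : measurable_fun setT (E : Omega -> edge_config V).

Definition cluster_event (A : set (Defs.rgraph d)) : set Omega :=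
  [set w | exists2 G : Defs.rgraph d, A G & iso_to_cluster o (E w) G].

(** Invariance under isomorphism, among the graphs that represent a cluster.  It
    makes [cluster_event] commute with complements. *)
Definition cluster_invariant (A : set (Defs.rgraph d)) : Prop :=
  forall w G G', iso_to_cluster o (E w) G -> iso_to_cluster o (E w) G' ->
    A G -> A G'.

(** Isomorphism to a given r-ball depends only on the edges in the r-ball of the
    tree, which is finite. *)
Lemma cluster_event_basis A : rg_basis (d := d) A ->
  measurable (cluster_event A) /\ cluster_invariant A.
Proof.
move=> [H [r ->]]; split; last first.
  move=> w G G' iG iG' /= HG; apply: rg_iso_balls_trans HG _.
  by apply: (rg_iso_balls_cluster hT (sE w) (sE w) _ iG iG').
pose B := [set y | (tree_dist T o y <= r)%N].
pose ev S := exists2 G : Defs.rgraph d, rg_iso_balls r H G & iso_to_cluster o S G.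
apply: (measurable_local_event mE (D := B `*` B) (P := ev)).
  by apply: finite_setX; exact: (finite_tree_ball hT).
move=> w w' agr [G HG iG].
have [G' iG'] := cluster_representative o hT (sE w').
exists G' => //; apply: rg_iso_balls_trans HG _.
apply: (rg_iso_balls_cluster hT (sE w) (sE w') _ iG iG') => x y xr yr.
exact: (agr (x, y)).
Qed.

(** The sets with both properties form a sigma-algebra: each cluster has a
    representative, and by invariance all of its representatives agree on
    membership, so that complements correspond to complements. *)
Lemma measurable_cluster_event (A : set (rooted_graphs d)) : measurable A ->
  measurable (cluster_event A) /\ cluster_invariant A.
Proof.
pose M := [set A : set (Defs.rgraph d) | measurable (cluster_event A) /\ cluster_invariant A].
suff : <<s rg_basis (d := d) >> `<=` M by apply.
apply: smallest_sub; last by move=> B; exact: cluster_event_basis.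
split.
- split=> //; rewrite (_ : cluster_event _ = set0)//.
  by apply/seteqP; split=> // w [].
- move=> B [mB iB]; split; last first.
    by move=> w G G' iG iG' [_ nB]; split => // BG'; apply: nB; exact: (iB _ _ _ iG' iG BG').
  rewrite (_ : cluster_event _ = ~` cluster_event B); first exact: measurableC.
  apply/seteqP; split=> w.
    by move=> [G [_ nB] iG] [G' BG' iG']; apply: nB; exact: (iB _ _ _ iG' iG BG').
  move=> nB; have [G iG] := cluster_representative o hT (sE w).
  by exists G => //; split => // BG; apply: nB; exists G.
- move=> F FM; split; last first.
    move=> w G G' iG iG' [k _ Fk]; exists k => //.
    by have [_ inv] := FM k; exact: (inv _ _ _ iG iG' Fk).
  rewrite (_ : cluster_event _ = \bigcup_k cluster_event (F k)).
    by apply: bigcupT_measurable => k; have [] := FM k.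
  apply/seteqP; split=> w.
    by move=> [G [k _ Fk] iG]; exists k => //; exists G.
  by move=> [k _ [G Fk iG]]; exists G => //; exists k.
Qed.

(** Measurability is what makes the equality of laws usable: an almost sure set
    of graphs contains a measurable set of measure 1, whose event has
    probability 1 and a measurable null complement. *)
Lemma cluster_ae (mu : probability (rooted_graphs d) R)
    (A : set (Defs.rgraph d)) :
  cluster_has_law P E o mu -> {ae mu, forall G, A G} ->
  {ae P, forall w, cluster_event A w}.
Proof.
move=> law [N [mN N0 AN]].
have mNC : measurable (~` N) by exact: measurableC.
have [mC _] := measurable_cluster_event mNC.
exists (~` cluster_event (~` N)); split; first exact: measurableC.
  rewrite probability_setC//.
  have -> : P (cluster_event (~` N)) = mu (~` N) by exact: law.
  by rewrite probability_setC// N0 sube0 subee.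
move=> w nA [G nNG iG]; apply: nA; exists G => //.
by apply: contrapT => nAG; apply: nNG; exact: AN.
Qed.

End cluster_law.

(** * The cospectral exponent *)

(** At [h = sqrt m] the two summands of the eigenvalue coincide, which gives the
    value of the second case. *)
Lemma cospectral_valueE (R : realType) (d : nat) (g : R) :
  1 <= d%:R - 1 :> R -> 0 < g ->
  cospectral_value d (ln g) =
  tree_eigenvalue (d%:R - 1) (Num.max g (Num.sqrt (d%:R - 1))).
Proof.
rewrite /cospectral_value /tree_eigenvalue subrK; set m := d%:R - 1 => m1 g0.
set s := Num.sqrt m.
have m0 : 0 < m by lra.
have s0 : 0 < s by rewrite sqrtr_gt0.
have ss : s * s = m by rewrite -expr2 sqr_sqrtr// ltW.
have -> : 2^-1 * ln m = ln s.
  by rewrite -ss lnM ?posrE//; lra.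
rewrite ler_ln ?posrE// lnK ?posrE//; case: leP => sg.
  rewrite -ss mulrAC mulrDr; congr (_ / _).
  by rewrite [s * (g / s)]mulrC divfK ?gt_eqF// mulrA.
by rewrite -ss mulfK ?gt_eqF// mulr_natl mulr2n.
Qed.

Lemma sampling_limit (R : realType) (dW : measure_display) (W : measurableType dW)
    (Q : probability W R) (V : countType) (d : nat) (T : graph V) (o : V)
    (a g : R) (X : nat -> W -> V) (S : rel V) :
  (2 <= d)%N -> 0 <= a -> a <= 1 -> regular_tree d T -> subrel S (gedge T) ->
  markov_chain Q (hold_step a d T) o X ->
  growth_seq R (perc_cluster S o) o @ \oo --> g ->
  sampling_seq Q X (gvert (perc_cluster S o)) @ \oo -->
    a + (1 - a) * cospectral_value d (ln g).
Proof.
move=> d2 a0 a1 hT ST hX Bg.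
have m1 : 1 <= d%:R - 1 :> R by rewrite lerBrDr (_ : 1 + 1 = 2%:R)// ler_nat.
have BE : growth_seq R (perc_cluster S o) o =
  fun n => (\sum_(k < n.+1) cluster_sphere T S o k)%:R `^ (n%:R)^-1.
  by apply/funext => n; rewrite /growth_seq (card_cluster_ball o hT).
rewrite BE in Bg.
have s0 := cluster_sphere0 S o hT.
have g1 : 1 <= g.
  apply: growth_ge1 Bg => n.
  by rewrite ler1n big_ord_recl s0.
rewrite cospectral_valueE//; last by lra.
have -> : sampling_seq Q X (gvert (perc_cluster S o)) = fun n =>
    sampled_mass (d%:R - 1) a (cluster_sphere T S o) (2 * n) `^ ((2 * n)%:R)^-1.
  apply/funext => n; rewrite /sampling_seq (sampling_cluster hT _ hX)//.
  exact: leq_trans d2.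
exact: (sampled_mass_root m1 a0 a1 s0 (cluster_sphereS o hT ST) Bg).
Qed.

Theorem corollary6p5 (R : realType) (d : nat) (hd : (2 <= d)%N)
  (mu : probability (rooted_graphs d) R)
  (hmu : unimodular_random_tree mu)
  (hgr : {ae mu, forall G, has_growth R (rg_graph G) (val (rg_root G))})
  (V : countType) (T : graph V) (hT : regular_tree d T) (o : V)
  (dO : measure_display) (Omega : measurableType dO) (P : probability Omega R)
  (E : Omega -> V -> V -> bool)
  (hE : invariant_edge_percolation P T E)
  (hlaw : cluster_has_law P E o mu)
  (dX : measure_display) (WX : measurableType dX) (QX : probability WX R)
  (X : nat -> WX -> V) (hX : markov_chain QX (lazy_step d T) o X)
  (dY : measure_display) (WY : measurableType dY) (QY : probability WY R)
  (Y : nat -> WY -> V) (hY : markov_chain QY (simple_step d T) o Y) :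
  {ae P, forall w,
    let C := gvert (perc_cluster (E w) o) in
    let gamma : R := ln (growth R (perc_cluster (E w) o) o) in
    (cvgn (sampling_seq QY Y C) /\
     sampling_exponent QY Y C = cospectral_value d gamma) /\
    (cvgn (sampling_seq QX X C) /\
     sampling_exponent QX X C = 2^-1 * (1 + cospectral_value d gamma))}.
Proof.
have [sE mE _] := hE; have [sT _ _ _ _] := hT.
apply: filterS (cluster_ae hT sE mE hlaw hgr) => w [G gG [f [iso fo]]].
have [symE ET] := sE w.
set C := gvert _ => /=; set g := growth _ _ _.
have Bg : growth_seq R (perc_cluster (E w) o) o @ \oo --> g.
  have fin n : finite_set (gball (perc_cluster (E w) o) (f (val (rg_root G))) n).
    rewrite fo (gball_cluster o hT ET); exact: (finite_cluster_ball _ _ hT).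
  have := growth_graph_iso R (cgraph_simple G) (cluster_simple o hT (sE w)) iso
    (set_valP _) fin.
  by rewrite fo => seqE; rewrite /g /growth -seqE.
have limY := sampling_limit hd (lexx 0) ler01 hT ET _ Bg.
have half0 : 0 <= 2^-1 :> R by lra.
have half1 : 2^-1 <= 1 :> R by lra.
have limX := sampling_limit hd half0 half1 hT ET _ Bg.
rewrite (simple_stepE _ _ sT) in hY; rewrite lazy_stepE in hX.
have {}limY := limY _ _ _ _ hY; have {}limX := limX _ _ _ _ hX.
rewrite add0r subr0 mul1r in limY.
have halfE t : 2^-1 + (1 - 2^-1) * t = 2^-1 * (1 + t) :> R by lra.
rewrite halfE in limX.
split; split; [exact: cvgP limY|exact: cvg_lim limY|exact: cvgP limX|].
exact: cvg_lim limX.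
Qed.
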